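(* In the setting of the dilute $A_4$ model described in the context (largest-eigenvalue sector, with its standing assumptions), the functions $T^{(1)},\dots,T^{(7)}$ satisfy, as identities of meromorphic functions of $x\in\mathbb C$, $$\begin{aligned} T^{(1)}(x-\tfrac16 i)\,T^{(1)}(x+\tfrac16 i) &= \phi(x-\tfrac53 i)\,T^{(2)}(x)+T_0(x\pm\tfrac56 i),\\ T^{(2)}(x-\tfrac16 i)\,T^{(2)}(x+\tfrac16 i) &= T_0(x)\,T_0(x\pm\tfrac46 i)+T^{(1)}(x)\,T^{(3)}(x),\\ T^{(3)}(x-\tfrac16 i)\,T^{(3)}(x+\tfrac16 i) &= T_0(x\pm\tfrac12 i)\,T_0(x\pm\tfrac16 i)+T^{(2)}(x)\,T^{(4)}(x)\,T^{(7)}(x),\\ T^{(4)}(x-\tfrac16 i)\,T^{(4)}(x+\tfrac16 i) &= T_0(x)\,T_0(x\pm\tfrac13 i)+T^{(3)}(x)\,T^{(5)}(x),\\ T^{(5)}(x-\tfrac16 i)\,T^{(5)}(x+\tfrac16 i) &= T_0(x\pm\tfrac16 i)+T^{(4)}(x)\,T^{(6)}(x),\\ T^{(6)}(x-\tfrac16 i)\,T^{(6)}(x+\tfrac16 i) &= T_0(x)+T^{(5)}(x),\\ T^{(7)}(x-\tfrac16 i)\,T^{(7)}(x+\tfrac16 i) &= T_0(x\pm\tfrac13 i)+T^{(3)}(x). \end{aligned}$$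
   Context: Convention: $f(x\pm iy):=f(x+iy)f(x-iy)$. Basic functions (dilute $A_4$ model). Put $\eta=\frac{3\pi}{10}$, fix $\tau>0$, $q=e^{-\tau}$, $\vartheta_1(z)=2q^{1/4}\sin z\prod_{n\ge1}(1-2q^{2n}\cos 2z+q^{4n})(1-q^{2n})$, and $h[x]=\vartheta_1(i\eta x)$. Let $N$ be a positive even integer, $u$ a real parameter, $w=e^{i\pi/5}$, $$\phi(x)=\Big(\frac{h[x+(\frac32-u)i]\,h[x-(\frac32-u)i]}{h[2i]\,h[3i]}\Big)^{N/2},\qquad Q(x)=\prod_{j=1}^N h[x-x_j].$$ Both $\phi$ and $Q$ have period $\frac{10}{3}i$. The complex numbers $x_1,\dots,x_N$ solve the Bethe ansatz equations $w\frac{\phi(x_j+i)}{\phi(x_j-i)}=-\frac{Q(x_j-i)Q(x_j+2i)}{Q(x_j+i)Q(x_j-2i)}$, $j=1,\dots,N$. Boxes: $b_1(x)=w\,\phi(x+\frac32 i)\phi(x+\frac12 i)\frac{Q(x-\frac52 i)}{Q(x-\frac12 i)}$, $b_2(x)=\phi(x+\frac32 i)\phi(x-\frac32 i)\frac{Q(x-\frac32 i)Q(x+\frac32 i)}{Q(x-\frac12 i)Q(x+\frac12 i)}$, $b_3(x)=w^{-1}\phi(x-\frac32 i)\phi(x-\frac12 i)\frac{Q(x+\frac52 i)}{Q(x+\frac12 i)}$. One-row functions: for $m\ge1$, $f_m(x)=\prod_{j=1}^{m-1}\phi(x\pm i(\frac{2m-1}{2}-j))$ and $$T_m(x)=\frac1{f_m(x)}\sum_{1\le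 i_1\le\cdots\le i_m\le3}\ \prod_{k=1}^m b_{i_k}\big(x+i(2k-1-m)\big);$$ $T_0(x)=\phi(x\pm\frac12 i)$ and $T_m=0$ for $m<0$. Standing assumptions (largest-eigenvalue sector): $T_m(x)=T_{7-m}(x)$ for $0\le m\le7$; $T_8=T_9=0$; $T_{m+10}(x)=T_m(x)$ for $m\ge-1$; and $Q(x)=\overline{Q(\bar x)}$. Skew diagrams: for partitions $\lambda\subset\mu$ ($\mu'_1$ = number of rows of $\mu$), $$\Lambda_{\mu/\lambda}(x)=\det_{1\le j,k\le\mu'_1}\Big(T^{\flat}_{\mu_j-\lambda_k-j+k}\big(x+i(\mu'_1-\mu_1+\mu_j+\lambda_k-j-k+1)\big)\Big),$$ where $T^\flat_m=T_m$ for $0\le m\le7$ and $T^\flat_m=0$ for $m<0$ or $m\ge8$. Definitions of $T^{(a)}$: $T^{(1)}(x)=T_1(x)$; $T^{(2)}(x)=\frac{1}{\phi(x-\frac53 i)}\Lambda_{(6,1)}(x-\frac56 i)$; $T^{(3)}(x)=\frac{1}{\phi(x\pm\frac32 i)}\Lambda_{(11,6,6)/(5,5)}(x)$; $T^{(5)}(x)=T_2(x+\frac53 i)$; $$\begin{aligned}T^{(6)}(x)=\tfrac1{\sqrt2}\Big(&w^2\phi(x+\tfrac23 i)\tfrac{Q(x+\frac23 i)}{Q(x-\frac13 i)}+w\,\phi(x-\tfrac43 i)\tfrac{Q(x-\frac43 i)Q(x+\frac53 i)}{Q(x-\frac13 i)Q(x+i)}+\phi(x)\tfrac{Q(x+\frac53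 i)Q(x)}{Q(x+i)Q(x-i)}\\&+w^{-1}\phi(x+\tfrac43 i)\tfrac{Q(x+\frac43 i)Q(x-\frac53 i)}{Q(x+\frac13 i)Q(x-i)}+w^{-2}\phi(x-\tfrac23 i)\tfrac{Q(x-\frac23 i)}{Q(x+\frac13 i)}\Big);\end{aligned}$$ $T^{(4)}(x)=T^{(5)}(x-\frac16 i)T^{(6)}(x+\frac13 i)-\phi(x+\frac23 i)\phi(x-\frac13 i)T^{(6)}(x-\frac13 i)$; $T^{(7)}(x)=\frac{1}{\phi(x-\frac43 i)}\big(T^{(1)}(x+\frac12 i)T^{(6)}(x-\frac23 i)-\phi(x)\phi(x-i)T^{(6)}(x+\frac43 i)\big)$. *)

(* Defs.v *)
(* Mathematical Components + MathComp-Analysis. *)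
From HB Require Import structures.
From mathcomp Require Import all_boot all_order all_algebra.
From mathcomp Require Import complex.
From mathcomp Require Import all_classical all_reals all_analysis.

Set Implicit Arguments.
Unset Strict Implicit.
Unset Printing Implicit Defensive.

Import Order.TTheory GRing.Theory Num.Theory.
Import numFieldNormedType.Exports.

Local Open Scope classical_set_scope.
Local Open Scope ring_scope.
Local Open Scope complex_scope.

Section ComplexFunctions.
Variable R : realType.
Local Notation C := R[i].

(* A meromorphic function is represented by a total function C -> C whose
   values at its poles are meaningless (x / 0 = 0).  Two such functions
   represent the same meromorphic function iff they agree on a punctured
   neighbourhood of every point, i.e. off a set without accumulation point. *)
Definition mero_eq (f g : C -> C) : Prop :=
  forall z : C, \forall x \near (z : C^o)^', f x = g x.

(* f(x +- i y) := f(x + i y) f(x - i y) *)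
Definition pm (f : C -> C) (x y : C) : C := f (x + y * 'i%C) * f (x - y * 'i%C).

Definition cexp (z : C) : C :=
  (expR (complex.Re z))%:C *
  (cos (complex.Im z) +i* sin (complex.Im z)).

Definition ccos (z : C) : C := (cexp ('i%C * z) + cexp (- ('i%C * z))) / 2.

Definition csin (z : C) : C := (cexp ('i%C * z) - cexp (- ('i%C * z))) / (2 * 'i%C).

Definition theta1_factor (q : R) (z : C) (n : nat) : C :=
  (1 - 2 * q%:C ^+ (2 * n) * ccos (2 * z) + q%:C ^+ (4 * n)) *
  (1 - q%:C ^+ (2 * n)).

Definition theta1 (q : R) (z : C) : C :=
  2 * (q `^ 4^-1)%:C * csin z *
  lim ((fun K : nat => \prod_(1 <= n < K.+1) theta1_factor q z n : C^o) @ \oo).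

End ComplexFunctions.

Section DiluteA4.
Variable R : realType.
Local Notation C := R[i].

Definition eta : R := 3 * pi / 10.

Definition w : C := cexp ((pi / 5)%:C * 'i%C).

Definition h (tau : R) (x : C) : C := theta1 (expR (- tau)) ('i%C * eta%:C * x).

(* N is meant to be even *)
Definition dilute_phi (tau u : R) (N : nat) (x : C) : C :=
  (h tau (x + (3 / 2 - u%:C) * 'i%C) * h tau (x - (3 / 2 - u%:C) * 'i%C) /
   (h tau (2 * 'i%C) * h tau (3 * 'i%C))) ^+ N./2.

Definition dilute_Q (tau : R) (N : nat) (xs : 'I_N -> C) (x : C) : C :=
  \prod_(j < N) h tau (x - xs j).

End DiluteA4.

Section Fusion.
Variable R : realType.
Local Notation C := R[i].
Local Notation w := (w R).
Variables phi Q : C -> C.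

(* Solving the equation includes both of its sides being defined. *)
Definition bethe_equations (N : nat) (xs : 'I_N -> C) : Prop :=
  forall j : 'I_N,
    [/\ phi (xs j - 'i%C) != 0,
        Q (xs j + 'i%C) * Q (xs j - 2 * 'i%C) != 0 &
        w * (phi (xs j + 'i%C) / phi (xs j - 'i%C)) =
        - ((Q (xs j - 'i%C) * Q (xs j + 2 * 'i%C)) /
           (Q (xs j + 'i%C) * Q (xs j - 2 * 'i%C)))].

Definition b1 (x : C) : C :=
  w * phi (x + 3 / 2 * 'i%C) * phi (x + 1 / 2 * 'i%C) *
  (Q (x - 5 / 2 * 'i%C) / Q (x - 1 / 2 * 'i%C)).

Definition b2 (x : C) : C :=
  phi (x + 3 / 2 * 'i%C) * phi (x - 3 / 2 * 'i%C) *
  ((Q (x - 3 / 2 * 'i%C) * Q (x + 3 / 2 * 'i%C)) /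
   (Q (x - 1 / 2 * 'i%C) * Q (x + 1 / 2 * 'i%C))).

Definition b3 (x : C) : C :=
  w^-1 * phi (x - 3 / 2 * 'i%C) * phi (x - 1 / 2 * 'i%C) *
  (Q (x + 5 / 2 * 'i%C) / Q (x + 1 / 2 * 'i%C)).

(* The indices 1, 2, 3 are the elements 0, 1, 2 of 'I_3. *)
Definition box (i : 'I_3) (x : C) : C :=
  match val i with 0%N => b1 x | 1%N => b2 x | _ => b3 x end.

Definition f_row (m : nat) (x : C) : C :=
  \prod_(1 <= j < m) pm phi x ((2 * m%:R - 1) / 2 - j%:R).

(* The row position k is 0-based here, hence k.+1. *)
Definition T_row (m : nat) (x : C) : C :=
  1 / f_row m x *
  \sum_(s : m.-tuple 'I_3 | sorted leq (map val s))
    \prod_(k < m) box (tnth s k) (x + 'i%C * (2 * k.+1%:R - 1 - m%:R)).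

Definition T (m : int) (x : C) : C :=
  match m with
  | Posz 0 => pm phi x (1 / 2)
  | Posz m' => T_row m' x
  | Negz _ => 0
  end.

Definition largest_eigenvalue_sector : Prop :=
  [/\ forall m : int, 0 <= m <= 7 -> mero_eq (T m) (T (7 - m)),
      mero_eq (T 8) (fun _ => 0) /\ mero_eq (T 9) (fun _ => 0),
      forall m : int, -1 <= m -> mero_eq (T (m + 10)) (T m) &
      forall x : C, Q x = conjc (Q (conjc x))].

Definition Tflat (m : int) (x : C) : C :=
  if (0 <= m) && (m <= 7) then T m x else 0.

(* mu lists the positive parts of a partition, so that size mu is its number
   of rows; missing parts of la are 0.  The indices j, k of the matrix are
   0-based, hence j.+1 and k.+1. *)
Definition Lambda (mu la : seq nat) (x : C) : C :=
  \det (\matrix_(j < size mu, k < size mu)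
    Tflat ((nth 0%N mu j)%:Z - (nth 0%N la k)%:Z - j.+1%:Z + k.+1%:Z)
      (x + 'i%C * ((size mu)%:Z - (nth 0%N mu 0)%:Z + (nth 0%N mu j)%:Z
                 + (nth 0%N la k)%:Z - j.+1%:Z - k.+1%:Z + 1)%:~R)).

Definition TE1 (x : C) : C := T 1 x.

Definition TE2 (x : C) : C :=
  1 / phi (x - 5 / 3 * 'i%C) * Lambda [:: 6; 1]%N [::] (x - 5 / 6 * 'i%C).

Definition TE3 (x : C) : C :=
  1 / pm phi x (3 / 2) * Lambda [:: 11; 6; 6]%N [:: 5; 5]%N x.

Definition TE5 (x : C) : C := T 2 (x + 5 / 3 * 'i%C).

Definition TE6 (x : C) : C :=
  1 / (Num.sqrt (2 : R))%:C *
  (w ^+ 2 * phi (x + 2 / 3 * 'i%C) *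
     (Q (x + 2 / 3 * 'i%C) / Q (x - 1 / 3 * 'i%C))
   + w * phi (x - 4 / 3 * 'i%C) *
     ((Q (x - 4 / 3 * 'i%C) * Q (x + 5 / 3 * 'i%C)) /
      (Q (x - 1 / 3 * 'i%C) * Q (x + 'i%C)))
   + phi x * ((Q (x + 5 / 3 * 'i%C) * Q x) / (Q (x + 'i%C) * Q (x - 'i%C)))
   + w^-1 * phi (x + 4 / 3 * 'i%C) *
     ((Q (x + 4 / 3 * 'i%C) * Q (x - 5 / 3 * 'i%C)) /
      (Q (x + 1 / 3 * 'i%C) * Q (x - 'i%C)))
   + w ^- 2 * phi (x - 2 / 3 * 'i%C) *
     (Q (x - 2 / 3 * 'i%C) / Q (x + 1 / 3 * 'i%C))).

Definition TE4 (x : C) : C :=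
  TE5 (x - 1 / 6 * 'i%C) * TE6 (x + 1 / 3 * 'i%C)
  - phi (x + 2 / 3 * 'i%C) * phi (x - 1 / 3 * 'i%C) * TE6 (x - 1 / 3 * 'i%C).

Definition TE7 (x : C) : C :=
  1 / phi (x - 4 / 3 * 'i%C) *
  (TE1 (x + 1 / 2 * 'i%C) * TE6 (x - 2 / 3 * 'i%C)
   - phi x * phi (x - 'i%C) * TE6 (x + 4 / 3 * 'i%C)).

End Fusion.

(* Main.v *)
(** Shifts of [x] by multiples of [i/6] form a cycle of length 20, since [phi]
and [Q] have period [10 i/3]; at a generic [x] everything becomes an identity
between finitely many nonzero values.

The functions [T_m] are Green functions of a third order difference operator
with step [2 i], built from the three boxes.  Five steps are three periods, and
the monodromy [M] of the operator over five steps has a flag of eigenvalues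
[w^5 = -1], [1], [w^-5 = -1].  The truncation [T_9 = 0], [T_10 = T_0],
[T_11 = T_1] says [M^2 = 1], so [1 + M] is twice a rank one projector.  Its
matrix elements [T_m + T_(m+5)] therefore factorize, and the five terms of
[T^(6)] are the resummed geometric series for the invariant vector; this yields
[T6 (x - i k/6) T6 (x + i k/6)] for [k = 1, 3, 5].  With these three products
and the Jacobi-Trudi identities for ribbons and hooks (where columns of height 2
and 3 reduce to [T_1] and to products of [phi]), the system follows by algebra:
[T^(4)] is a continuant in [T^(6)], [T^(7)] a linear expression in [T^(6)]. *)

Require Import Defs.
From HB Require Import structures.
From mathcomp Require Import all_boot all_order all_algebra.
From mathcomp Require Import complex.
From mathcomp Require Import all_classical all_reals all_analysis.
From mathcomp Require Import ring lra zify.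

Set Implicit Arguments.
Unset Strict Implicit.
Unset Printing Implicit Defensive.

Import Order.TTheory GRing.Theory Num.Theory.
Import numFieldNormedType.Exports.

Local Open Scope classical_set_scope.
Local Open Scope ring_scope.
Local Open Scope complex_scope.

(** * Sequences of period 20 and the rank-one factorization *)

Lemma per_eq (V : Type) (f : int -> V) (fper : forall p, f (p + 20) = f p) (a b k : int) :
  a = b + 20 * k -> f a = f b.
Proof.
have fn (n : nat) c : f (c + 20 * n%:Z) = f c.
  elim: n => [|n IH]; first by rewrite mulr0 addr0.
  by rewrite -IH -[RHS]fper intS mulrDr mulr1 [20 + _]addrC addrA.
move=> ->; case: k => n; first exact: fn.
by rewrite -(fn n.+1 (b + _)) NegzE mulrN subrK.
Qed.

(* Replaces each [f (.. p ..)] by [f (p + c)] with [0 <= c < 20]. *)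
Ltac canon f fper p :=
  repeat match goal with |- context [f ?a] =>
    let g := eval pattern p in a in
    lazymatch g with ?h _ =>
      let c0 := eval vm_compute in (`|((h (0:int)) %% 20)%Z|%N) in
      let k := eval vm_compute in ((h (0:int)) %/ 20)%Z in
      lazymatch a with
      | (p + Posz c0)%R => fail
      | _ => rewrite (@per_eq _ f fper a (p + Posz c0) k); [|by lia]
      end
    end
  end.

(* [y], [u], [v] solve the triangular system of difference equations, with
   monodromies [-Phi], [Phi], [-Phi] over five steps.  Where [y] has period ten
   up to [Phi ^+ 2], the combination [y (m + 5) + Phi * y m] lies in the
   one-dimensional eigenspace of the middle eigenvalue; [S] is the geometric
   series that lifts the solution of the second equation to the first. *)
Lemma rank_one_rows (K : comNzRingType) (B1 B2 B3 y u v : nat -> K) (Phi : K) :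
  (forall k, B1 (k + 5)%N = B1 k) ->
  (forall k, B2 (k + 5)%N = B2 k) ->
  (forall k, B3 (k + 5)%N = B3 k) ->
  B1 0%N * B1 1%N * B1 2 * B1 3 * B1 4 = - Phi ->
  B2 0%N * B2 1%N * B2 2 * B2 3 * B2 4 = Phi ->
  B3 0%N * B3 1%N * B3 2 * B3 3 * B3 4 = - Phi ->
  y 0%N = 1 -> u 0%N = 1 -> v 0%N = 1 ->
  (forall k, y k.+1 = B1 k * y k + u k.+1) ->
  (forall k, u k.+1 = B2 k * u k + v k.+1) ->
  (forall k, v k.+1 = B3 k * v k) ->
  let z := B2 4 * u 4 in
  let S j c := B2 j.+3 * B2 j.+2 * B2 j.+1 * B2 j * c
    + B1 j.+3 * B2 j.+2 * B2 j.+1 * B2 j * c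
    + B1 j.+3 * B1 j.+2 * B2 j.+1 * B2 j * c
    + B1 j.+3 * B1 j.+2 * B1 j.+1 * B2 j * c
    + B1 j.+3 * B1 j.+2 * B1 j.+1 * B1 j * c in
  [/\ y 9 = 0 -> 2 * Phi * y 4 = S 0%N z,
      y 10 = Phi ^+ 2 * y 0%N -> 2 * Phi * (y 5 + Phi * y 0%N) = S 1%N (B2 0%N * z) &
      y 11 = Phi ^+ 2 * y 1%N ->
        2 * Phi * (y 6 + Phi * y 1%N) = S 2 (B2 1%N * B2 0%N * z)].
Proof.
move=> p1 p2 p3 e1 e2 e3 y0 u0 v0 ry ru rv z S.
have pv : forall j, v (j + 5)%N = - Phi * v j.
  elim=> [|j IH]; last by rewrite addSn !rv IH p3; ring.
  by rewrite !rv v0 -e3; ring.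
have z0 : u 5 + Phi * u 0%N = z by rewrite ru (pv 0%N) u0 v0 /z; ring.
(* The source terms cancel because [v] gains the factor [- Phi] over five steps; hence
   [u (j + 5) + Phi * u j] solves the homogeneous second equation, with initial value [z]. *)
have zS j : u (j + 6)%N + Phi * u j.+1 = B2 j * (u (j + 5)%N + Phi * u j).
  by rewrite (addnS j 5) !ru p2 -addSn (pv j.+1); ring.
have y5 j : B1 j.+4 * B1 j.+3 * B1 j.+2 * B1 j.+1 * B1 j = - Phi.
  elim: j => [|j IH]; first by rewrite -e1; ring.
  by rewrite -IH -(p1 j) addnS addn4; ring.
have yS j : y (j + 5)%N = - Phi * y j + u (j + 5)%N + B1 j.+4 * u j.+4
    + B1 j.+4 * B1 j.+3 * u j.+3 + B1 j.+4 * B1 j.+3 * B1 j.+2 * u j.+2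
    + B1 j.+4 * B1 j.+3 * B1 j.+2 * B1 j.+1 * u j.+1.
  by rewrite -(y5 j) addnS addn4 !ry; ring.
have := (z0, zS 0%N, zS 1%N, zS 2, zS 3, zS 4, zS 5).
rewrite !addSn !add0n => zs.
split.
- move=> y9.
  have y4 : y 4 = u 4 + B1 3 * u 3 + B1 3 * B1 2 * u 2 + B1 3 * B1 2 * B1 1%N * u 1%N
      + B1 3 * B1 2 * B1 1%N * B1 0%N * u 0%N.
    by rewrite !ry y0 u0; ring.
  (* The five-step expansion of [y 9] contains [- Phi * y 4], so [Phi * y 4] survives once;
     expanding it as well pairs every [u (k + 5)] with [Phi * u k]. *)
  transitivity (y 9 + 2 * Phi * y 4); first by rewrite y9; ring.
  rewrite (yS 4).
  transitivity ((u 9 + Phi * u 4) + B1 8 * (u 8 + Phi * u 3)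
    + B1 8 * B1 7 * (u 7 + Phi * u 2) + B1 8 * B1 7 * B1 6 * (u 6 + Phi * u 1%N)
    + B1 8 * B1 7 * B1 6 * B1 5 * (u 5 + Phi * u 0%N)).
    by rewrite y4 -(p1 3) -(p1 2) -(p1 1%N) -(p1 0%N); ring.
  rewrite !zs /S -(p1 3) -(p1 2) -(p1 1%N) -(p1 0%N); ring.
- move=> y10.
  transitivity (y 10 - Phi ^+ 2 * y 0%N + 2 * Phi * (y 5 + Phi * y 0%N)); first by rewrite y10;
    ring.
  rewrite (yS 5) (yS 0%N).
  transitivity ((u 10 + Phi * u 5) + B1 9 * (u 9 + Phi * u 4)
    + B1 9 * B1 8 * (u 8 + Phi * u 3) + B1 9 * B1 8 * B1 7 * (u 7 + Phi * u 2)
    + B1 9 * B1 8 * B1 7 * B1 6 * (u 6 + Phi * u 1%N)).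
    by rewrite -(p1 4) -(p1 3) -(p1 2) -(p1 1%N); ring.
  rewrite !zs /S -(p1 4) -(p1 3) -(p1 2) -(p1 1%N); ring.
- move=> y11.
  transitivity (y 11 - Phi ^+ 2 * y 1%N + 2 * Phi * (y 6 + Phi * y 1%N)); first by rewrite y11;
    ring.
  rewrite (yS 6) (yS 1%N).
  transitivity ((u 11 + Phi * u 6) + B1 10 * (u 10 + Phi * u 5)
    + B1 10 * B1 9 * (u 9 + Phi * u 4) + B1 10 * B1 9 * B1 8 * (u 8 + Phi * u 3)
    + B1 10 * B1 9 * B1 8 * B1 7 * (u 7 + Phi * u 2)).
    by rewrite -(p1 5) -(p1 4) -(p1 3) -(p1 2); ring.
  rewrite !zs /S -(p1 5) -(p1 4) -(p1 3) -(p1 2); ring.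
Qed.

(** * The values on the cycle of shifts *)

(* [f p] and [q p] stand for [phi (x + p i/6)] and [Q (x + p i/6)]. *)
Section Lattice.
Variables (K : fieldType) (w : K) (f q : int -> K).

Definition lat_b1 p := w * f (p + 9) * f (p + 3) * (q (p - 15) / q (p - 3)).
Definition lat_b2 p := f (p + 9) * f (p - 9) * ((q (p - 9) * q (p + 9)) / (q (p - 3) * q (p + 3))).
Definition lat_b3 p := w^-1 * f (p - 9) * f (p - 3) * (q (p + 15) / q (p + 3)).

(* Sums over the weakly increasing fillings of a row of [m] boxes whose last box
   is at position [e], with entries in {3}, {2, 3} and {1, 2, 3}. *)
Fixpoint row3 e m := if m is m'.+1 then lat_b3 (e - (12 * m')%N%:Z) * row3 e m' else 1.
Fixpoint row2 e m := if m is m'.+1 then lat_b2 (e - (12 * m')%N%:Z) * row2 e m' + row3 e m else 1.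
Fixpoint row1 e m := if m is m'.+1 then lat_b1 (e - (12 * m')%N%:Z) * row1 e m' + row2 e m else 1.

(** The index is lower by one: [lat_f n] is [f_row n.+1], built from the smallest shift outwards;
    the shift [j + 1 / 2] is [6 * j + 3] sixths. *)
Fixpoint lat_f n p :=
  if n is n'.+1 then lat_f n' p * (f (p + (6 * n' + 3)%N%:Z) * f (p - (6 * n' + 3)%N%:Z)) else 1.

Definition lat_T m p :=
  if m is m'.+1 then row1 (p + (6 * m')%N%:Z) m / lat_f m' p else f (p + 3) * f (p - 3).

(* [Num.sqrt 2] times [T^(6)] *)
Definition lat_F p :=
  w ^+ 2 * f (p + 4) * (q (p + 4) / q (p - 2))
  + w * f (p - 8) * ((q (p - 8) * q (p + 10)) / (q (p - 2) * q (p + 6)))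
  + f p * ((q (p + 10) * q p) / (q (p + 6) * q (p - 6)))
  + w^-1 * f (p + 8) * ((q (p + 8) * q (p - 10)) / (q (p + 2) * q (p - 6)))
  + w ^- 2 * f (p - 4) * (q (p - 4) / q (p + 2)).

Hypothesis fper : forall p : int, f (p + 20) = f p.
Hypothesis qper : forall p : int, q (p + 20) = q p.
Hypothesis fn0 : forall p, f p != 0.
Hypothesis qn0 : forall p, q p != 0.
Hypothesis w5 : w ^+ 5 = -1.

Lemma w_neq0 : w != 0.
Proof. by apply/eqP => w0; move/eqP: w5; rewrite w0 expr0n /= eq_sym oppr_eq0 oner_eq0. Qed.

(** All odd shifts of a cycle, each once, so that only the parity of [p] matters. Up to sign this is
    the monodromy of each box over five steps. *)
Definition phi_prod p := f (p + 1) * f (p + 3) * f (p + 5) * f (p + 7) * f (p + 9)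
  * f (p + 11) * f (p + 13) * f (p + 15) * f (p + 17) * f (p + 19).

Ltac lcanon p := canon f fper p; canon q qper p.
Ltac lfield := field; rewrite ?fn0 ?qn0 ?w_neq0 //.

Lemma lat_b1_per p : lat_b1 (p + 20) = lat_b1 p.
Proof. by rewrite /lat_b1; lcanon p. Qed.
Lemma lat_b2_per p : lat_b2 (p + 20) = lat_b2 p.
Proof. by rewrite /lat_b2; lcanon p. Qed.
Lemma lat_b3_per p : lat_b3 (p + 20) = lat_b3 p.
Proof. by rewrite /lat_b3; lcanon p. Qed.

Lemma per60 (g : int -> K) (gper : forall p : int, g (p + 20) = g p) p : g (p - 60) = g p.
Proof. by apply: (@per_eq _ _ gper _ _ (-3)); lia. Qed.

(** Steps by -12 visit the multiples of 4 modulo 20. Numerators and denominators in [q] thus run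
    through the same residues, the two factors [f] together cover each odd shift once, and [w ^+ 5]
    gives the sign. The other boxes behave alike, with signs [1] and [w ^- 5]. *)
Lemma lat_b1_prod p :
  lat_b1 p * lat_b1 (p - 12) * lat_b1 (p - 24) * lat_b1 (p - 36) * lat_b1 (p - 48)
  = - phi_prod p.
Proof.
rewrite -[RHS]mulN1r -w5 /phi_prod /lat_b1; lcanon p; lfield.
Qed.
Lemma lat_b2_prod p :
  lat_b2 p * lat_b2 (p - 12) * lat_b2 (p - 24) * lat_b2 (p - 36) * lat_b2 (p - 48)
  = phi_prod p.
Proof.
rewrite /phi_prod /lat_b2; lcanon p; lfield.
Qed.
Lemma lat_b3_prod p :
  lat_b3 p * lat_b3 (p - 12) * lat_b3 (p - 24) * lat_b3 (p - 36) * lat_b3 (p - 48)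
  = - phi_prod p.
Proof.
have m1 : - phi_prod p = w ^- 5 * phi_prod p by rewrite w5 invrN1 mulN1r.
rewrite m1 /phi_prod /lat_b3; lcanon p; lfield.
Qed.

Lemma rank_one_lattice e :
  let B1 k := lat_b1 (e - (12 * k)%N%:Z) in let B2 k := lat_b2 (e - (12 * k)%N%:Z) in
  let z := B2 4%N * row2 e 4 in
  let S j c := B2 j.+3 * B2 j.+2 * B2 j.+1 * B2 j * c
    + B1 j.+3 * B2 j.+2 * B2 j.+1 * B2 j * c
    + B1 j.+3 * B1 j.+2 * B2 j.+1 * B2 j * c
    + B1 j.+3 * B1 j.+2 * B1 j.+1 * B2 j * c
    + B1 j.+3 * B1 j.+2 * B1 j.+1 * B1 j * c in
  [/\ row1 e 9 = 0 -> 2 * phi_prod e * row1 e 4 = S 0%N z,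
      row1 e 10 = phi_prod e ^+ 2 -> 2 * phi_prod e * (row1 e 5 + phi_prod e) = S 1%N (B2 0%N * z) &
      row1 e 11 = phi_prod e ^+ 2 * row1 e 1 ->
        2 * phi_prod e * (row1 e 6 + phi_prod e * row1 e 1) = S 2 (B2 1%N * B2 0%N * z)].
Proof.
move=> B1 B2 z S.
have sh k : e - (12 * (k + 5))%N%:Z = e - (12 * k)%N%:Z - 60.
  by rewrite mulnDr PoszD opprD addrA.
have p1 k : B1 (k + 5)%N = B1 k by rewrite /B1 sh (per60 lat_b1_per).
have p2 k : B2 (k + 5)%N = B2 k by rewrite /B2 sh (per60 lat_b2_per).
have p3 k : lat_b3 (e - (12 * (k + 5))%N%:Z)
  = lat_b3 (e - (12 * k)%N%:Z) by rewrite sh (per60 lat_b3_per).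
have e1 : B1 0%N * B1 1%N * B1 2%N * B1 3%N * B1 4%N = - phi_prod e.
  by rewrite /B1 -lat_b1_prod muln0 subr0.
have e2 : B2 0%N * B2 1%N * B2 2%N * B2 3%N * B2 4%N = phi_prod e.
  by rewrite /B2 -lat_b2_prod muln0 subr0.
have e3 := lat_b3_prod e; rewrite -{1}[e]subr0 in e3.
have [r4 r5 r6] := @rank_one_rows K B1 B2 (fun k => lat_b3 (e - (12 * k)%N%:Z))
  (row1 e) (row2 e) (row3 e) (phi_prod e) p1 p2 p3 e1 e2 e3 erefl erefl erefl
  (fun=> erefl) (fun=> erefl) (fun=> erefl).
by split=> // h; have := r5 (etrans h (esym (mulr1 _))); rewrite [row1 e 0]/= mulr1.
Qed.

(** Powers of [w] match the terms: the summand with [k] factors [lat_b1] is the prefactor times the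
    term of [lat_F] with exponent [k - 2]. *)
Lemma rank_one_left p : lat_b2 (p - 18) * lat_b2 (p - 6) * lat_b2 (p + 6) * lat_b2 (p + 18)
  + lat_b1 (p - 18) * lat_b2 (p - 6) * lat_b2 (p + 6) * lat_b2 (p + 18)
  + lat_b1 (p - 18) * lat_b1 (p - 6) * lat_b2 (p + 6) * lat_b2 (p + 18)
  + lat_b1 (p - 18) * lat_b1 (p - 6) * lat_b1 (p + 6) * lat_b2 (p + 18)
  + lat_b1 (p - 18) * lat_b1 (p - 6) * lat_b1 (p + 6) * lat_b1 (p + 18)
  = w ^+ 2 * (phi_prod p / (f (p + 1) * f (p + 13) * f (p + 19)) * (q (p + 7) / q (p + 1))) *
    lat_F (p - 3).
Proof.
rewrite /phi_prod /lat_b1 /lat_b2 /lat_F; lcanon p; lfield.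
Qed.

(** The filling of four boxes with [k] entries 3, the others being 2, corresponds to the term of
    [lat_F] with exponent [2 - k] of [w]. *)
Lemma rank_one_right e p : e = p + 18 -> row2 e 4
  = w ^- 2 * (phi_prod p / (f (p + 1) * f (p + 7) * f (p + 19)) * (q (p - 7) / q (p - 1))) *
    lat_F (p + 3).
Proof.
move=> ->.
rewrite /phi_prod /= /lat_b3 /lat_b2 /lat_F; lcanon p; lfield.
Qed.

(** * Products of two values of [lat_F] *)

Lemma row3_per e m : row3 (e + 20) m = row3 e m.
Proof. by elim: m => //= m ->; rewrite addrAC lat_b3_per. Qed.
Lemma row2_per e m : row2 (e + 20) m = row2 e m.
Proof. by elim: m => //= m ->; rewrite row3_per addrAC lat_b2_per lat_b3_per. Qed.
Lemma row1_per e m : row1 (e + 20) m = row1 e m.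
Proof. by elim: m => //= m ->;
  rewrite row2_per row3_per addrAC lat_b1_per lat_b2_per lat_b3_per. Qed.
Lemma lat_f_per n p : lat_f n (p + 20) = lat_f n p.
Proof. by elim: n => //= n ->; rewrite ![p + 20 + _]addrAC !fper. Qed.
Lemma lat_T_per m p : lat_T m (p + 20) = lat_T m p.
Proof.
case: m => [|m]; first by rewrite /lat_T ![p + 20 + _]addrAC !fper.
by rewrite /lat_T addrAC row1_per lat_f_per.
Qed.
Lemma phi_prod_neq0 p : phi_prod p != 0.
Proof. by rewrite /phi_prod !mulf_neq0. Qed.
Lemma lat_f_neq0 n p : lat_f n p != 0.
Proof. by elim: n => [|n IH] /=; rewrite ?oner_eq0 // !mulf_neq0. Qed.

Ltac bcanon p := canon lat_b1 lat_b1_per p; canon lat_b2 lat_b2_per p; canon lat_b3 lat_b3_per p.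

Lemma lat_TS m p : lat_T m.+1 p = row1 (p + (6 * m)%N%:Z) m.+1 / lat_f m p.
Proof. by []. Qed.

Lemma lat_T_eq0 m p : lat_T m.+1 p = 0 -> row1 (p + (6 * m)%N%:Z) m.+1 = 0.
Proof. by move=> /eqP; rewrite mulf_eq0 invr_eq0 (negPf (lat_f_neq0 _ _)) orbF => /eqP. Qed.

Lemma lat_FF3 p : lat_T 9 (p + 10) = 0 -> lat_F (p - 3) * lat_F (p + 3) = 2 * lat_T 4 p.
Proof.
move=> /lat_T_eq0 T9; have [r4 _ _] := rank_one_lattice (p + 18).
(* The nine boxes centred at [p + 10] end at [p + 58], which modulo 20 is [p + 18], the end of the
   four boxes centred at [p]. *)
have {T9} T9 : row1 (p + 18) 9 = 0 by rewrite -T9; apply: (@per_eq _ _ (row1_per^~ 9) _ _ (-2));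
  lia.
move/r4: T9; cbv zeta beta => {r4}; bcanon p.
have := rank_one_left p; bcanon p => e.
move=> h; have {e h} := etrans h
  (etrans _ (congr1 (fun c => c * (lat_b2 (p + Posz 10) * row2 (p + 18) 4)) e)).
move=> /(_ ltac:(ring)).
rewrite (@rank_one_right _ p) // /lat_T => e.
have -> : row1 (p + (6 * 3)%N) 4 = row1 (p + Posz 18) 4 by [].
apply: (mulfI (phi_prod_neq0 p)).
transitivity (2 * phi_prod (p + 18) * row1 (p + 18) 4 / lat_f 3 p); last first.
  have -> : phi_prod (p + 18) = phi_prod p by rewrite /phi_prod; lcanon p; ring.
  ring.
rewrite e /phi_prod /lat_b2 /=; lcanon p.
lfield.
Qed.

Lemma lat_F_per p : lat_F (p + 20) = lat_F p.
Proof. by rewrite /lat_F; lcanon p. Qed.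

Lemma lat_FF1 p : lat_T 10 p = lat_T 0 p -> lat_F (p - 1) * lat_F (p + 1)
  = 2 * (lat_T 0 p + lat_T 5 (p + 10)).
Proof.
(* Both rows, ten boxes centred at [p] and five centred at [p + 10], end at [p - 6] modulo 20. *)
move=> /(canRL (divfK (lat_f_neq0 _ _))) T10; have [_ r5 _] := rank_one_lattice (p - 6).
have {T10} T10 : row1 (p - 6) 10 = phi_prod (p - 6) ^+ 2.
  rewrite (@per_eq _ _ (row1_per^~ 10) _ (p + (6 * 9)%N%:Z) (-3)); last by lia.
  (* [lat_T 0 p] and the nine pairs in [lat_f 9 p] contain every odd shift exactly twice. *)
  by rewrite T10 /lat_T /phi_prod /=; lcanon p; ring.
move/r5: T10; cbv zeta beta => {r5}; bcanon p.
(* The series [S 1] runs over the boxes from [p - 18] down to [p - 54], centred at [p + 4] modulo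
   20. *)
have := rank_one_left (p + 4); bcanon p => e.
move=> h; have {e h} := etrans h
  (etrans _ (congr1 (fun c => c *
    (lat_b2 (p + Posz 14) * (lat_b2 (p + Posz 6) * row2 (p - 6) 4))) e)).
move=> /(_ ltac:(ring)).
rewrite (@rank_one_right _ (p - 24)); last by lia.
move=> e.
apply: (mulfI (phi_prod_neq0 p)).
transitivity (2 * phi_prod (p - 6) * (row1 (p - 6) 5 + phi_prod (p - 6)) / lat_f 4 (p + 10));
  last first.
  have -> : phi_prod (p - 6) = phi_prod p by rewrite /phi_prod; lcanon p; ring.
  have -> : row1 (p - 6) 5 = row1 (p + 10 + (6 * 4)%N%:Z) 5.
    by apply: (@per_eq _ _ (row1_per^~ 5) _ _ (-2)); lia.
  rewrite lat_TS; move: (row1 _ 5) => y.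
  rewrite /phi_prod /lat_T /=; lcanon p; lfield.
rewrite e /phi_prod /lat_b2 /=; lcanon p; canon lat_F lat_F_per p.
lfield.
Qed.

Lemma lat_FF5 p : lat_T 11 p = lat_T 1 p -> lat_F (p - 5) * lat_F (p + 5)
  = 2 * (lat_T 1 p + lat_T 6 (p + 10)).
Proof.
(* The rows of eleven boxes and of one box centred at [p], and of six boxes centred at [p + 10], all
   end at [p] modulo 20. *)
move=> /(canRL (divfK (lat_f_neq0 _ _))) T11; have [_ _ r6] := rank_one_lattice p.
have {T11} T11 : row1 p 11 = phi_prod p ^+ 2 * row1 p 1.
  rewrite (@per_eq _ _ (row1_per^~ 11) _ (p + (6 * 10)%N%:Z) (-3)); last by lia.
  rewrite T11 /lat_T /phi_prod [lat_f 0 p]/= addr0 invr1 mulr1 mulrC; congr (_ * _).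
  by rewrite /=; lcanon p; ring.
move/r6: T11; cbv zeta beta => {r6}; bcanon p.
have := rank_one_left (p - 2); bcanon p => e.
move=> h; have {e h} := etrans h
  (etrans _ (congr1 (fun c => c *
    (lat_b2 (p + Posz 8) * lat_b2 (p + Posz 0) * (lat_b2 (p + Posz 12) * row2 p 4))) e)).
move=> /(_ ltac:(ring)).
rewrite (@rank_one_right _ (p - 18)); last by lia.
move=> e.
apply: (mulfI (phi_prod_neq0 p)).
transitivity (2 * phi_prod p * (row1 p 6 + phi_prod p * row1 p 1) / lat_f 5 (p + 10)); last first.
  have -> : row1 p 6 = row1 (p + 10 + (6 * 5)%N%:Z) 6.
    by apply: (@per_eq _ _ (row1_per^~ 6) _ _ (-2)); lia.
  rewrite !lat_TS [lat_f 0 p]/= addr0 invr1 mulr1.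
  move: (row1 _ 6) (row1 _ 1) => y y'.
  rewrite /phi_prod /=; lcanon p; lfield.
rewrite e /phi_prod /lat_b2 /=; lcanon p; canon lat_F lat_F_per p.
lfield.
Qed.

(** * Jacobi-Trudi identities for columns, hooks and a ribbon *)

Definition box_sum p := lat_b1 p + lat_b2 p + lat_b3 p.
Definition col2_sum p := lat_b1 (p + 6) * lat_b2 (p - 6) + lat_b1 (p + 6) * lat_b3 (p - 6)
  + lat_b2 (p + 6) * lat_b3 (p - 6).

Lemma lat_T0E p : lat_T 0 p = f (p + 3) * f (p - 3).
Proof. by []. Qed.

Lemma lat_T1E p : lat_T 1 p = box_sum p.
Proof. by rewrite lat_TS /= invr1 !mulr1 muln0 addr0 subr0 addrA. Qed.

(** Term by term, the columns with entries 12, 13 and 23 reduce to the boxes 1, 2 and 3, the same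
    scalar splitting off each time. *)
Lemma col2_sumE p : col2_sum p = f (p + 15) * f (p - 15) * lat_T 1 p.
Proof.
rewrite lat_T1E /col2_sum /box_sum /lat_b1 /lat_b2 /lat_b3; lcanon p; lfield.
Qed.

(** The only filling of a column of height three; all its factors [q] and [w] cancel. *)
Lemma col3E p : lat_b1 (p + 12) * lat_b2 p * lat_b3 (p - 12)
  = f (p + 1) * f (p + 15) * f (p + 9) * f (p - 9) * f (p - 1) * f (p - 15).
Proof. rewrite /lat_b1 /lat_b2 /lat_b3; lcanon p; lfield. Qed.

(** [lat_T 0 p] is the denominator of [lat_T 2 p], so the subtraction removes the weakly increasing
    fillings from all fillings of two boxes and leaves the columns. *)
Lemma lat_col2 p : lat_T 1 (p - 6) * lat_T 1 (p + 6) - lat_T 0 p * lat_T 2 p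
  = f (p + 15) * f (p - 15) * lat_T 1 p.
Proof.
rewrite -col2_sumE !lat_T1E /col2_sum /box_sum lat_TS /lat_T /=; bcanon p; lcanon p; lfield.
Qed.

(** What remains are the fillings of [p - 12], [p], [p + 12] that first increase weakly and then
    descend: a free box times a column of height two, minus the column of height three. In
    [lat_hookr] the descent comes first. *)
Lemma lat_hookl p : lat_T 1 (p + 12) * lat_T 2 (p - 6) - lat_T 0 (p + 6) * lat_T 3 p
  = f (p + 1) / f (p - 3)
    * (lat_T 1 (p - 12) * lat_T 1 (p + 6) - f (p + 15) * f (p + 9) * f (p + 5) * f (p - 1)).
Proof.
transitivity ((box_sum (p - 12) * col2_sum (p + 6)
  - lat_b1 (p + 12) * lat_b2 p * lat_b3 (p - 12)) / (f (p - 3) * f (p - 9))).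
  rewrite !lat_T1E /col2_sum /box_sum !lat_TS /lat_T /=; bcanon p; lcanon p; lfield.
rewrite col2_sumE col3E !lat_T1E; lcanon p; lfield.
Qed.

Lemma lat_hookr p : lat_T 1 (p - 12) * lat_T 2 (p + 6) - lat_T 0 (p - 6) * lat_T 3 p
  = f (p - 1) / f (p + 3)
    * (lat_T 1 (p + 12) * lat_T 1 (p - 6) - f (p - 15) * f (p - 9) * f (p - 5) * f (p + 1)).
Proof.
transitivity ((col2_sum (p - 6) * box_sum (p + 12)
  - lat_b1 (p + 12) * lat_b2 p * lat_b3 (p - 12)) / (f (p + 3) * f (p + 9))).
  rewrite !lat_T1E /col2_sum /box_sum !lat_TS /lat_T /=; bcanon p; lcanon p; lfield.
rewrite col2_sumE col3E !lat_T1E; lcanon p; lfield.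
Qed.

(** Modulo 20 the two rows are adjacent, and the fillings left have a descent between them.
    Inclusion-exclusion on the outer pairs gives three terms, since a column of height four has no
    filling by three letters. *)
Lemma lat_ribbon22 p : lat_T 2 (p + 8) * lat_T 2 (p - 8) - lat_T 0 p * lat_T 4 p
  = (lat_T 1 (p + 2) * lat_T 1 p * lat_T 1 (p - 2)
     - lat_T 1 (p + 2) * lat_T 0 (p + 4) * lat_T 0 (p - 6)
     - lat_T 1 (p - 2) * lat_T 0 (p - 4) * lat_T 0 (p + 6)) / (f (p + 9) * f (p - 9)).
Proof.
transitivity ((box_sum (p - 18) * col2_sum p * box_sum (p + 18)
  - box_sum (p - 18) * (lat_b1 (p + 18) * lat_b2 (p + 6) * lat_b3 (p - 6))
  - box_sum (p + 18) * (lat_b1 (p + 6) * lat_b2 (p - 6) * lat_b3 (p - 18)))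
  / (f (p + 9) * f (p + 15) * f (p - 9) * f (p - 15))).
  rewrite /col2_sum /box_sum !lat_TS /lat_T /=; bcanon p; lcanon p; lfield.
rewrite col2_sumE !lat_T1E !lat_T0E.
have := col3E (p + 6); have := col3E (p - 6); rewrite /box_sum; bcanon p; lcanon p => -> ->; lfield.
Qed.

End Lattice.

(** * The algebraic form of the system *)

(* [t], [t2], [t3] and [F] stand for [T_1], [T_2], [T_3] and [T^(6)].  In the
   proofs, [transitivity] displays the difference of the two sides as a
   combination of differences that vanish by the hypotheses. *)
Section E7.
Variables (K : fieldType) (f t t2 t3 F : int -> K).
Hypothesis fper : forall p : int, f (p + 20) = f p.
Hypothesis tper : forall p : int, t (p + 20) = t p.
Hypothesis t2per : forall p : int, t2 (p + 20) = t2 p.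
Hypothesis t3per : forall p : int, t3 (p + 20) = t3 p.
Hypothesis Fper : forall p : int, F (p + 20) = F p.
Hypothesis fn0 : forall p, f p != 0.

Definition sysT0 p := f (p + 3) * f (p - 3).
Hypothesis FF1 : forall p, F (p - 1) * F (p + 1) = sysT0 p + t2 (p + 10).
Hypothesis FF3 : forall p, F (p - 3) * F (p + 3) = t3 p.
Hypothesis FF5 : forall p, F (p - 5) * F (p + 5) = t p + t (p + 10).
Hypothesis col2 : forall p,
  t (p - 6) * t (p + 6) - sysT0 p * t2 p = f (p + 15) * f (p - 15) * t p.
Hypothesis hookl : forall p, t (p + 12) * t2 (p - 6) - sysT0 (p + 6) * t3 p
  = f (p + 1) / f (p - 3)
    * (t (p - 12) * t (p + 6) - f (p + 15) * f (p + 9) * f (p + 5) * f (p - 1)).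
Hypothesis hookr : forall p, t (p - 12) * t2 (p + 6) - sysT0 (p - 6) * t3 p
  = f (p - 1) / f (p + 3)
    * (t (p + 12) * t (p - 6) - f (p - 15) * f (p - 9) * f (p - 5) * f (p + 1)).

(** [sysT2] and [sysT3] are the determinants of T^(2) and T^(3) multiplied out after T_6 = T_1 and
    T_7 = T_0: continuants of length two and three in [t]. *)
Definition sysT2 p := (t (p + 1) * t (p - 1) - sysT0 (p - 5) * sysT0 (p + 5)) / f (p - 10).
Definition sysT3 p := (t (p + 2) * t p * t (p - 2) - t (p + 2) * sysT0 (p + 4) * sysT0 (p - 6)
  - t (p - 2) * sysT0 (p - 4) * sysT0 (p + 6)) / (f (p + 9) * f (p - 9)).
Definition sysT4 p := t2 (p + 9) * F (p + 2) - f (p + 4) * f (p - 2) * F (p - 2).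
Definition sysT7 p := (t (p + 3) * F (p - 4) - f p * f (p - 6) * F (p + 8)) / f (p - 8).

Hypothesis ribbon22 : forall p, t2 (p + 8) * t2 (p - 8) - sysT0 p * t3 p = sysT3 p.

Ltac ecanon p := canon f fper p; canon t tper p; canon t2 t2per p; canon t3 t3per p; canon F Fper p.
Ltac efield := field; rewrite ?fn0 //.

Lemma e7_id1 p : t (p - 1) * t (p + 1) = f (p - 10) * sysT2 p + sysT0 (p + 5) * sysT0 (p - 5).
Proof. rewrite /sysT2; efield. Qed.

(** Euler's identity for continuants of lengths one, two and three. *)
Lemma e7_id2 p : sysT2 (p - 1) * sysT2 (p + 1) = sysT0 p * (sysT0 (p + 4) * sysT0 (p - 4))
  + t p * sysT3 p.
Proof. rewrite /sysT2 /sysT3 /sysT0; ecanon p; efield. Qed.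

(** By [FF1], [t2] and [sysT4] are continuants of length two and three in [F], so this is Euler's
    identity again. *)
Lemma e7_id5 p : t2 (p + 9) * t2 (p + 11) = sysT0 (p + 1) * sysT0 (p - 1) + sysT4 p * F p.
Proof.
apply/eqP; rewrite -subr_eq0; apply/eqP.
transitivity (f (p + 4) * f (p - 2) * (F (p - 2) * F p - (sysT0 (p - 1) + t2 (p + 9)))
  - t2 (p + 9) * (F p * F (p + 2) - (sysT0 (p + 1) + t2 (p + 11)))).
  rewrite /sysT4 /sysT0; ecanon p; ring.
have := FF1 (p - 1); have := FF1 (p + 1).
by rewrite /sysT0; ecanon p => -> ->; rewrite !subrr !mulr0 subrr.
Qed.

(** After [ribbon22] replaces [sysT3], the four products of [F] on the left have index distances 2
    and 6, covered by [FF1] and [FF3]. *)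
Lemma e7_id4 p : sysT4 (p - 1) * sysT4 (p + 1) = sysT0 p * (sysT0 (p + 2) * sysT0 (p - 2))
  + sysT3 p * t2 (p + 10).
Proof.
apply/eqP; rewrite -subr_eq0; apply/eqP; rewrite -ribbon22.
transitivity (t2 (p + 8) * t2 (p + 10) * (F (p + 1) * F (p + 3) - (sysT0 (p + 2) + t2 (p + 12)))
  - t2 (p + 8) * sysT0 (p + 2) * (F (p - 1) * F (p + 1) - (sysT0 p + t2 (p + 10)))
  - sysT0 p * t2 (p + 10) * (F (p - 3) * F (p + 3) - t3 p)
  + sysT0 p * sysT0 (p + 2) * (F (p - 3) * F (p - 1) - (sysT0 (p - 2) + t2 (p + 8)))).
  rewrite /sysT4 /sysT0; ecanon p; ring.
have := FF1 (p - 2); have := FF1 (p + 2); have := FF1 p; have := FF3 p.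
rewrite /sysT0; ecanon p => -> -> -> ->; ring.
Qed.

(** Modulo 20 the four products of [F] have distances 2, 6, 10 and 2. [FF1], [FF3] and [FF5]
    evaluate them; [hookl] and [col2] then eliminate [t3] and [t2]. *)
Lemma e7_id7 p : sysT7 (p - 1) * sysT7 (p + 1) = sysT0 (p + 2) * sysT0 (p - 2) + sysT3 p.
Proof.
apply/eqP; rewrite -subr_eq0; apply/eqP.
transitivity ((t (p + 2) * t (p + 4) * (F (p - 5) * F (p - 3) - (sysT0 (p - 4) + t2 (p + 6)))
  - t (p + 2) * sysT0 (p - 2) * (F (p + 9) * F (p - 5) - t3 (p + 12))
  - t (p + 4) * sysT0 (p - 4) * (F (p - 3) * F (p + 7) - (t (p + 2) + t (p + 12)))
  + sysT0 (p - 4) * sysT0 (p - 2) * (F (p + 7) * F (p + 9) - (sysT0 (p + 8) + t2 (p - 2)))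
  + t (p + 2) * ((t (p + 4) * t2 (p + 6) - sysT0 (p - 2) * t3 (p + 12)) - f (p + 13) / f (p + 9)
    * (t p * t (p - 2) - f (p + 7) * f (p + 1) * f (p - 3) * f (p + 11)))
  - sysT0 (p - 4) * ((t (p + 12) * t (p + 4) - sysT0 (p - 2) * t2 (p - 2))
    - f (p + 13) * f (p + 3) * t (p - 2)))
  / (f (p - 9) * f (p - 7))).
  rewrite /sysT7 /sysT3 /sysT0; ecanon p; efield.
have := FF1 (p - 4); have := FF3 (p + 12); have := FF5 (p + 2); have := FF1 (p + 8).
have := hookl (p + 12); have := col2 (p - 2).
rewrite /sysT0; ecanon p => -> -> -> -> -> ->; rewrite !subrr; ring.
Qed.

Lemma e7_id3 p : sysT3 (p - 1) * sysT3 (p + 1)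
  = sysT0 (p + 3) * sysT0 (p - 3) * (sysT0 (p + 1) * sysT0 (p - 1)) + sysT2 p * sysT4 p * sysT7 p.
Proof.
(* The continuant developed from its other end; the coefficient [t2 (p + 11)] is the one that occurs
   in [ribbon22] at [p - 1] and in [hookr] at [p + 5]. *)
have h4 : sysT4 p = t2 (p + 11) * F (p - 2) - sysT0 (p - 1) * F (p + 2).
  apply/eqP; rewrite -subr_eq0; apply/eqP.
  transitivity (F (p - 2) * (F p * F (p + 2) - (sysT0 (p + 1) + t2 (p + 11)))
    - F (p + 2) * (F (p - 2) * F p - (sysT0 (p - 1) + t2 (p + 9)))).
    rewrite /sysT4 /sysT0; ecanon p; ring.
  have := FF1 (p - 1); have := FF1 (p + 1).
  by rewrite /sysT0; ecanon p => -> ->; rewrite !subrr !mulr0 subrr.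
(* This product no longer contains [F], which leaves an identity in [t] and [f] alone. *)
have h47 : sysT4 p * sysT7 p = (t (p + 3) * sysT3 (p - 1) - sysT0 (p - 3) * (f (p + 4) / f (p + 8))
  * (t (p - 3) * t (p - 1) - f (p - 10) * f (p - 4) * f p * f (p + 6))) / f (p - 8).
  rewrite h4 -ribbon22; apply/eqP; rewrite -subr_eq0; apply/eqP.
  transitivity ((t2 (p + 11) * t (p + 3) * (F (p - 4) * F (p - 2) - (sysT0 (p - 3) + t2 (p + 7)))
    - t2 (p + 11) * sysT0 (p - 3) * (F (p - 2) * F (p + 8) - (t (p + 3) + t (p + 13)))
    - sysT0 (p - 1) * t (p + 3) * (F (p - 4) * F (p + 2) - t3 (p - 1))
    + sysT0 (p - 1) * sysT0 (p - 3) * (F (p + 2) * F (p + 8) - t3 (p + 5))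
    - sysT0 (p - 3) * ((t (p - 7) * t2 (p + 11) - sysT0 (p - 1) * t3 (p + 5))
      - f (p + 4) / f (p + 8)
    * (t (p + 17) * t (p - 1) - f (p - 10) * f (p - 4) * f p * f (p + 6)))) / f (p - 8)).
    rewrite /sysT7 /sysT0; ecanon p; efield.
  have := FF1 (p - 3); have := FF5 (p + 3); have := FF3 (p - 1); have := FF3 (p + 5).
  have := hookr (p + 5).
  rewrite /sysT0; ecanon p => -> -> -> -> ->; rewrite !subrr; ring.
rewrite -(mulrA (sysT2 p)) h47 /sysT3 /sysT2 /sysT0; ecanon p; efield.
Qed.
End E7.

(** * Zeros and period of [theta1] *)

Section GeometricSteps.
Variable R : realType.
Local Notation C := R[i].

Lemma geometric_steps_cvg (u : R^nat) (c r : R) : 0 <= r < 1 ->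
  (forall k, `|u k.+1 - u k| <= c * r ^+ k) -> cvgn u.
Proof.
move=> /andP[r0 r1] hu.
have c0 : 0 <= c by have := le_trans (normr_ge0 _) (hu 0%N); rewrite expr0 mulr1.
have /cvg_ex[l hl] : cvgn (series (telescope u)).
  apply: normed_cvg; apply: (@series_le_cvg _ _ (geometric c r)).
  - by move=> n; exact: normr_ge0.
  - by move=> n; rewrite /geometric /= mulr_ge0 // exprn_ge0.
  - by move=> n; exact: hu.
  - by apply: is_cvg_geometric_series; rewrite ger0_norm.
have [u0 hu0] : exists x, x = u 0%N by exists (u 0%N).
apply/cvg_ex; exists (l + u0).
have -> : u = (fun n => series (telescope u) n + u0).
  by apply/funext => n; rewrite telescopeK /= hu0 subrK.
exact: (cvgD hl (cvg_cst _)).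
Qed.

Lemma ler_normc_Re (z : C) : `|complex.Re z|%:C <= `|z|.
Proof.
case: z => a b; rewrite normc_def lecR /= -sqrtr_sqr ler_sqrt ?lerDl ?sqr_ge0 //.
by rewrite addr_ge0 ?sqr_ge0.
Qed.

Lemma ler_normc_Im (z : C) : `|complex.Im z|%:C <= `|z|.
Proof.
case: z => a b; rewrite normc_def lecR /= -sqrtr_sqr ler_sqrt ?lerDr ?sqr_ge0 //.
by rewrite addr_ge0 ?sqr_ge0.
Qed.

Lemma ler_normc_sum (z : C) : `|z| <= (`|complex.Re z| + `|complex.Im z|)%:C.
Proof.
rewrite {1}[z]complexE (le_trans (ler_normD _ _)) // rmorphD /= lerD //.
  by rewrite normc_def /= expr0n /= addr0 sqrtr_sqr.
by rewrite normrM !normc_def /= !expr0n /= add0r addr0 expr1n sqrtr1 mul1r sqrtr_sqr.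
Qed.

Lemma cvg_complex (u : nat -> C) (a b : R) :
  complex.Re (u n) @[n --> \oo] --> a -> complex.Im (u n) @[n --> \oo] --> b ->
  (u : nat -> C^o) @ \oo --> (a +i* b : C^o).
Proof.
move=> ua ub; apply/cvgrPdist_lt => e.
rewrite ltcE /= => /andP[/eqP ime e0].
have e20 : 0 < complex.Re e / 2 by rewrite divr_gt0.
move/cvgrPdist_lt/(_ _ e20): ua => ua; move/cvgrPdist_lt/(_ _ e20): ub => ub.
near=> n.
apply: le_lt_trans (ler_normc_sum _) _.
have -> : e = (complex.Re e)%:C by case: (e) ime => x y /= ->.
rewrite ltcR [ltRHS]splitr; case E: (u n) => [x y] /=.
by apply: ltrD; [have -> : x = complex.Re (u n) by rewrite E
  |have -> : y = complex.Im (u n) by rewrite E]; near: n.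
Unshelve. all: by end_near.
Qed.

(** Real and imaginary parts inherit the bound on the steps, so each converges. *)
Lemma geometric_steps_cvgC (u : nat -> C) (c r : R) : 0 <= r < 1 ->
  (forall k, `|u k.+1 - u k| <= (c * r ^+ k)%:C) ->
  exists l : C, (u : nat -> C^o) @ \oo --> (l : C^o).
Proof.
move=> r01 hu.
have /cvg_ex[a ha] : cvgn (fun n => complex.Re (u n)).
  apply: (@geometric_steps_cvg _ c r) => // k.
  by rewrite -lecR -raddfB; apply: le_trans (ler_normc_Re _) (hu k).
have /cvg_ex[b hb] : cvgn (fun n => complex.Im (u n)).
  apply: (@geometric_steps_cvg _ c r) => // k.
  by rewrite -lecR -raddfB; apply: le_trans (ler_normc_Im _) (hu k).
by exists (a +i* b); exact: cvg_complex.
Qed.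
End GeometricSteps.

(** * Nonvanishing of infinite products *)

Section InfiniteProduct.
Variable R : realType.
Local Notation C := R[i].

(** A finite nonzero product [P] is split off so that the geometric majorant of the remaining terms
    sums to at most 1/4. The tail products then stay within 1/2 of 1, and their limit cannot be
    0. *)
Lemma infinite_prod_neq0 (a : nat -> C) (M r : R) : 0 <= r < 1 ->
  (forall n, `|a n| <= (M * r ^+ n)%:C) -> (forall n, (0 < n)%N -> 1 + a n != 0) ->
  lim ((fun K : nat => \prod_(1 <= n < K.+1) (1 + a n) : C^o) @ \oo) != 0.
Proof.
move=> r01 ha an0; have /andP[r0 r1] := r01.
have M0 : 0 <= M.
  by have := le_trans (normr_ge0 _) (ha 0%N); rewrite expr0 mulr1 ler0c.
have r'0 : 0 < 1 - r by rewrite subr_gt0.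
have [N hN] : exists N, M * r ^+ N.+1 / (1 - r) <= 1 / 4.
  have : (M / (1 - r)) * r ^+ n @[n --> \oo] --> (M / (1 - r)) * 0.
    by apply: cvgM; [exact: cvg_cst | apply: cvg_expr; rewrite ger0_norm].
  rewrite mulr0 => /cvgrPdist_lt /(_ (1 / 4)) [|N _ /(_ N.+1 (leqnSn _))];
    first by rewrite divr_gt0.
  rewrite sub0r normrN => /ltW /(le_trans (ler_norm _)) h.
  by exists N; rewrite mulrAC.
set m := M * r ^+ N.+1 / (1 - r) in hN.
have m0 : 0 <= m by rewrite /m divr_ge0 ?mulr_ge0 ?exprn_ge0 // ltW.
pose P := \prod_(1 <= n < N.+1) (1 + a n).
pose T k := \prod_(N.+1 <= n < N.+1 + k) (1 + a n).
have TS k : T k.+1 - T k = T k * a (N.+1 + k)%N.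
  by rewrite /T addnS big_nat_recr ?leq_addr //= mulrDr mulr1 addrAC subrr add0r.
have rk k : r ^+ k <= 1 by rewrite exprn_ile1 // ltW.
(* The bound is twice the partial sum of the majorant; it keeps the tail below 2 in modulus, and
   this in turn closes the induction. *)
have T1 k : `|T k - 1| <= (2 * m * (1 - r ^+ k))%:C.
  elim: k => [|k IH]; first by rewrite /T addn0 big_geq // subrr normr0 expr0 subrr mulr0.
  have Tk2 : `|T k| <= 2%:C.
    rewrite -[T k](subrK 1) (le_trans (ler_normD _ _)) // normr1.
    rewrite (_ : 2%:C = 1 + 1) ?lerD2r; last by rewrite -[RHS]/(1%:C + 1%:C) -rmorphD.
    apply: (le_trans IH); rewrite lecR.
    have := rk k; have : 0 <= r ^+ k by rewrite exprn_ge0.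
    by move=> ? ?; nra.
  rewrite -[T k.+1](subrK (T k)) TS -addrA (le_trans (ler_normD _ _)) // normrM.
  apply: (le_trans (lerD (ler_pM (normr_ge0 _) (normr_ge0 _) Tk2 (ha _)) IH)).
  rewrite -rmorphM -rmorphD /= lecR /m exprD !exprS.
  rewrite le_eqVlt; apply/orP; left; apply/eqP.
  field; rewrite gt_eqF //.
have T12 k : `|T k - 1| <= (1 / 2)%:C.
  apply: (le_trans (T1 k)); rewrite lecR.
  have := rk k; have : 0 <= r ^+ k by rewrite exprn_ge0.
  by move=> ? ?; nra.
have Tk2 k : `|T k| <= 2%:C.
  rewrite -[T k](subrK 1) (le_trans (ler_normD _ _)) // normr1.
  rewrite (_ : 2%:C = 1 + 1) ?lerD2r; last by rewrite -[RHS]/(1%:C + 1%:C) -rmorphD.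
  apply: (le_trans (T12 k)); rewrite -[leRHS]/(1%:C) lecR; lra.
pose u k := P * T k.
have [l hl] : exists l : C, (u : nat -> C^o) @ \oo --> (l : C^o).
  apply: (@geometric_steps_cvgC _ u (complex.Re `|P| * 2 * (M * r ^+ N.+1)) r) => // k.
  rewrite /u -mulrBr TS !normrM.
  have -> : (complex.Re `|P| * 2 * (M * r ^+ N.+1) * r ^+ k)%:C
      = `|P| * (2%:C * (M * r ^+ (N.+1 + k))%:C).
    rewrite -rmorphM exprD {2}(_ : `|P| = (complex.Re `|P|)%:C); last by rewrite normc_def.
    by rewrite -rmorphM; congr (_%:C); ring.
  by rewrite ler_wpM2l // ler_pM.
have uE : (fun k => \prod_(1 <= n < (k + N).+1) (1 + a n)) = u.
  apply/funext => k; rewrite /u /P /T -(@big_cat_nat _ _ _ N.+1) //=; first by rewrite addSn addnC.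
  by rewrite addSn ltnS leq_addr.
have P0 : P != 0.
  rewrite /P big_seq_cond prodf_seq_neq0; apply/allP => n.
  by rewrite mem_index_iota => /andP[n0 _]; apply/implyP => _; exact: an0.
have -> : lim ((fun K : nat => \prod_(1 <= n < K.+1) (1 + a n) : C^o) @ \oo) = (l : C^o).
  apply: cvg_lim; first exact: norm_hausdorff.
  by rewrite -(cvg_shiftn N) /= uE.
apply/eqP => l0; move: hl; rewrite l0 => /cvgrPdist_lt /(_ (`|P| * (1 / 2)%:C))
  [|n _ /(_ n (leqnn _))].
  by rewrite mulr_gt0 ?normr_gt0 // ltcR; lra.
rewrite sub0r normrN /u normrM ltr_pM2l ?normr_gt0 // => Tn.
have : `|1 : C| < 1.
  rewrite -{1}(subrK (T n) 1) (le_lt_trans (ler_normD _ _)) // distrC.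
  apply: (lt_le_trans (ler_ltD (T12 n) Tn)).
  by rewrite -rmorphD -[leRHS]/(1%:C) lecR; lra.
by rewrite normr1 ltxx.
Qed.
End InfiniteProduct.

(** * The complex exponential, the zeros of [theta1] and the period of [h] *)

Section Theta.
Variable R : realType.
Local Notation C := R[i].

Lemma cexpD (a b : C) : cexp (a + b) = cexp a * cexp b.
Proof.
case: a b => [a1 a2] [b1 b2]; rewrite /cexp /= expRD cosD sinD.
apply/eqP; rewrite eq_complex /=; apply/andP; split; apply/eqP; ring.
Qed.

Lemma cexp0 : cexp 0 = 1 :> C.
Proof. by rewrite /cexp /= expR0 cos0 sin0 mul1r. Qed.

Lemma cexpNK (a : C) : cexp a * cexp (- a) = 1.
Proof. by rewrite -cexpD subrr cexp0. Qed.

Lemma cexp_neq0 (a : C) : cexp a != 0.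
Proof. by apply/eqP => a0; have := cexpNK a; rewrite a0 mul0r => /eqP; rewrite eq_sym oner_eq0. Qed.

Lemma cexpN (a : C) : cexp (- a) = (cexp a)^-1.
Proof. by apply: (mulfI (cexp_neq0 a)); rewrite cexpNK divff ?cexp_neq0. Qed.

Lemma cexpMn (a : C) n : cexp (a *+ n) = cexp a ^+ n.
Proof. by elim: n => [|n IH]; rewrite ?cexp0 // mulrS exprS cexpD IH. Qed.

Lemma mulCi (x : R) : x%:C * 'i%C = 0 +i* x.
Proof. by apply/eqP; rewrite eq_complex /= !(mulr0, mul0r, mulr1, subr0, addr0) !eqxx. Qed.

Lemma cexp_pii : cexp (pi%:C * 'i%C) = -1 :> C.
Proof.
rewrite mulCi /cexp /= expR0 cospi sinpi mul1r.
by apply/eqP; rewrite eq_complex /= oppr0 !eqxx.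
Qed.

Lemma cexpDpii (a : C) : cexp (a + pi%:C * 'i%C) = - cexp a.
Proof. by rewrite cexpD cexp_pii mulrN1. Qed.

Lemma cexpBpii (a : C) : cexp (a - pi%:C * 'i%C) = - cexp a.
Proof. by rewrite cexpD cexpN cexp_pii invrN1 mulrN1. Qed.

Lemma w_exp5 : w R ^+ 5 = -1.
Proof.
rewrite /w -cexpMn -cexp_pii; congr cexp.
rewrite -mulrnAl -raddfMn /=; congr (_%:C * _).
by rewrite -mulr_natr; field.
Qed.

Lemma csinBpi (z : C) : csin (z - pi%:C) = - csin z.
Proof.
rewrite /csin mulrBr [_ * pi%:C]mulrC opprB [pi%:C * _ - _]addrC cexpBpii cexpDpii.
by rewrite -opprD mulNr.
Qed.

Lemma ccos2Bpi (z : C) : ccos (2 * (z - pi%:C)) = ccos (2 * z).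
Proof.
have e : 'i%C * (2 * (z - pi%:C)) = 'i%C * (2 * z) - pi%:C * 'i%C - pi%:C * 'i%C by ring.
have e' : - ('i%C * (2 * (z - pi%:C))) = - ('i%C * (2 * z)) + pi%:C * 'i%C + pi%:C * 'i%C by ring.
by rewrite /ccos e' e !cexpBpii !cexpDpii !opprK.
Qed.

Lemma theta1Bpi q (z : C) : theta1 q (z - pi%:C) = - theta1 q z.
Proof.
rewrite /theta1 csinBpi.
have -> : theta1_factor q (z - pi%:C) = theta1_factor q z.
  by apply/funext => n; rewrite /theta1_factor ccos2Bpi.
by rewrite mulrN mulNr.
Qed.

Lemma theta1_factorE q (z : C) n : theta1_factor q z n =
  (1 - q%:C ^+ (2 * n) * cexp ('i%C * (2 * z))) *
  (1 - q%:C ^+ (2 * n) * (cexp ('i%C * (2 * z)))^-1) * (1 - q%:C ^+ (2 * n)).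
Proof.
rewrite /theta1_factor /ccos cexpN (_ : (4 * n = 2 * n * 2)%N); last by rewrite mulnAC.
by rewrite [q%:C ^+ (_ * 2)]exprM; have := cexp_neq0 ('i%C * (2 * z)); move: (cexp _) => c c0;
  field.
Qed.

Lemma theta1_factor_bound (q : R) (z : C) n : 0 < q < 1 ->
  `|theta1_factor q z n - 1| <= ((3 + 4 * complex.Re `|ccos (2 * z)|) * (q ^+ 2) ^+ n)%:C.
Proof.
move=> /andP[q0 q1]; rewrite /theta1_factor (_ : (4 * n = 2 * n * 2)%N); last by rewrite mulnAC.
rewrite [q%:C ^+ (_ * 2)]exprM.
have [X0 X1] : 0 <= q ^+ (2 * n) /\ q ^+ (2 * n) <= 1.
  by rewrite exprn_ge0 ?exprn_ile1 // ltW.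
rewrite -[q%:C ^+ (2 * n)]rmorphXn /= -exprM; move: (q ^+ (2 * n)) X0 X1 => X X0 X1.
set c := ccos _; set r := complex.Re `|c|.
have cr : `|c| = r%:C by rewrite /r normc_def.
have -> : (1 - 2 * X%:C * c + X%:C ^+ 2) * (1 - X%:C) - 1
    = X%:C * ((X%:C - 1 - X%:C ^+ 2) + (2 * (X%:C - 1)) * c) by ring.
have nR (x : R) : `|x%:C| = `|x|%:C by rewrite normc_def /= expr0n /= addr0 sqrtr_sqr.
rewrite [(_ * X)%:C]rmorphM /= [leRHS]mulrC.
rewrite normrM nR (ger0_norm X0). apply: ler_wpM2l; first by rewrite ler0c.
have -> : X%:C - 1 - X%:C ^+ 2 = (X - 1 - X ^+ 2)%:C by rewrite !rmorphB rmorphXn rmorph1 /=.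
have -> : 2 * (X%:C - 1) = (2 * (X - 1))%:C by rewrite rmorphM rmorphB rmorph1 rmorph_nat /=.
have r0 : 0 <= r by rewrite -ler0c -cr normr_ge0.
rewrite (le_trans (ler_normD _ _)) // normrM !nR cr -rmorphM -rmorphD lecR.
have a1 : `|X - 1 - X ^+ 2| <= 3 by rewrite ler_norml; apply/andP; split; nra.
have a2 : `|2 * (X - 1)| <= 4 by rewrite ler_norml; apply/andP; split; lra.
by rewrite lerD // ler_wpM2r.
Qed.

(** By contraposition: the sine can vanish only with [k = 0], the factor of index [n] only with
    [k = n] or [k = - n], and an infinite product of nonzero factors is nonzero. *)
Lemma theta1_eq0 (tau : R) (z : C) : 0 < tau -> theta1 (expR (- tau)) z = 0 ->
  exists k : int, cexp ('i%C * (2 * z)) = (expR (2 * tau * k%:~R))%:C.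
Proof.
move=> tau0; apply: contraPP => nz; apply/eqP.
have q0 : 0 < expR (- tau) by exact: expR_gt0.
have q1 : expR (- tau) < 1 by rewrite expR_lt1 oppr_lt0.
have qE n : (expR (- tau))%:C ^+ (2 * n) = (expR (2 * tau * (- n%:Z)%:~R))%:C :> C.
  rewrite -rmorphXn /= -expRM_natl; congr (expR _)%:C.
  by rewrite natrM mulrNz mulrN -pmulrn; ring.
rewrite /theta1 !mulf_neq0 //.
- by rewrite eq_complex /= negb_and gt_eqF // powR_gt0.
- apply/negP.
  rewrite subr_eq0 => /eqP e; apply: nz; exists 0.
  by rewrite mulr0 expR0 mulrCA -[2]/(1 *+ 2) mulrDl !mul1r cexpD {1}e mulrC cexpNK.
- by rewrite invr_eq0 mulf_neq0 // eq_complex /= oner_eq0 andbF.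
rewrite (_ : (fun K => _) = (fun K : nat => \prod_(1 <= n < K.+1)
    (1 + (theta1_factor (expR (- tau)) z n - 1)) : C^o)); last first.
  by apply/funext => K; apply: eq_bigr => n _; rewrite addrC subrK.
apply: (@infinite_prod_neq0 _ _ _ (expR (- tau) ^+ 2)).
- by rewrite exprn_ge0 ?expr_lt1 // ltW.
- by move=> n; apply: theta1_factor_bound; rewrite q0.
have exp_inv (x : R) : (expR (- x))%:C * (expR x)%:C = 1 :> C.
  by rewrite -rmorphM /= -expRD addNr expR0.
move=> n n0; rewrite addrC subrK theta1_factorE !qE !mulf_neq0 // subr_eq0 eq_sym; apply/eqP.
- move=> e; apply: nz; exists n%:Z.
  apply: (mulfI (x := (expR (2 * tau * (- n%:Z)%:~R))%:C)).
    by rewrite eq_complex /= gt_eqF ?expR_gt0.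
  by rewrite e mulrNz mulrN exp_inv.
- move=> e; apply: nz; exists (- n%:Z); apply: (divIf (cexp_neq0 ('i%C * (2 * z)))).
  by rewrite /= divff ?cexp_neq0.
move/(congr1 (@complex.Re R)) => /=; rewrite -[RHS]expR0 => /expR_inj /eqP;
  rewrite mulrNz mulrN oppr_eq0.
by rewrite !mulf_eq0 pnatr_eq0 (gt_eqF tau0) /= intr_eq0 eqz_nat gtn_eqF.
Qed.

Lemma cexp_eq_real (a : C) (x : R) : cexp a = (expR x)%:C ->
  [/\ complex.Re a = x, cos (complex.Im a) = 1 & sin (complex.Im a) = 0].
Proof.
case: a => a b; rewrite /cexp /= => /eqP; rewrite eq_complex /= !mul0r subr0 addr0.
move=> /andP[/eqP e1 /eqP]; rewrite ?addr0 ?add0r => /eqP.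
rewrite mulf_eq0 gt_eqF ?expR_gt0 //= => /eqP s0.
have c1 : cos b = 1.
  have := cos2Dsin2 b; rewrite s0 expr0n addr0 => /eqP.
  rewrite sqrf_eq1 => /orP[/eqP //|/eqP cN].
  by have := expR_gt0 x; rewrite -e1 cN mulrN1 oppr_gt0 ltNge expR_ge0.
by split=> //; apply: (@expR_inj R); rewrite -e1 c1 mulr1.
Qed.

Lemma sin_eq0_small (b : R) : `|b| < pi -> sin b = 0 -> b = 0.
Proof.
have pos (c : R) : 0 < c -> c < pi -> sin c <> 0.
  by move=> c0 c1 s0; have := @sin_gt0_pi R c; rewrite c0 c1 s0 ltxx => /(_ isT).
rewrite ltr_norml => /andP[b1 b2] s0; case: (ltrgtP b 0) => // h.
  case: (pos (- b)); rewrite ?oppr_gt0 ?sinN ?s0 ?oppr0 //.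
  by rewrite ltrNl.
by case: (pos b).
Qed.

Lemma eta_gt0 : 0 < Defs.eta R.
Proof. by rewrite /Defs.eta divr_gt0 // mulr_gt0 // pi_gt0. Qed.

(** Since [eta * 10 / 3 = pi], the argument of [theta1] moves by [- pi]. *)
Lemma h_period (tau : R) (x : C) : h tau (x + 10 / 3 * 'i%C) = - h tau x.
Proof.
rewrite /h -theta1Bpi; congr theta1; rewrite mulrDr; congr (_ + _).
rewrite (_ : 'i%C * (Defs.eta R)%:C * (10 / 3 * 'i%C)
  = 'i%C ^+ 2 * ((Defs.eta R)%:C * (10 / 3))); last by ring.
rewrite sqr_i mulN1r; congr (- _).
have -> : 10 / 3 = (10 / 3 : R)%:C by rewrite rmorphM fmorphV !rmorph_nat.
by rewrite -rmorphM; congr (_%:C); rewrite /Defs.eta; field.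
Qed.

(* The zeros of [theta1] lie on the lattice of points [k pi + i n tau]. *)
Lemma h_zeros_isolated (tau : R) (x y : C) : 0 < tau -> h tau x = 0 -> h tau y = 0 ->
  `|complex.Re (x - y)| < tau / Defs.eta R -> `|complex.Im (x - y)| < 1 -> x = y.
Proof.
move=> tau0 /(theta1_eq0 tau0) [k hk] /(theta1_eq0 tau0) [l hl] hr hi.
have eta0 := eta_gt0.
have E (z : C) : 'i%C * (2 * ('i%C * (Defs.eta R)%:C * z)) = - ((2 * Defs.eta R)%:C * z).
  move: (Defs.eta R) => c.
  rewrite (_ : 'i%C * (2 * ('i%C * c%:C * z)) = 'i%C ^+ 2 * (2 * c%:C * z)); last by ring.
  by rewrite sqr_i rmorphM rmorph_nat /=; ring.
rewrite !E in hk hl; clear E.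
(* With [2 * eta] below [pi], imaginary parts less than 1 apart give an angle smaller than [pi],
   where the sine vanishes only at 0. *)
have etapi : 2 * Defs.eta R < pi by have := pi_gt0 R; rewrite /Defs.eta; lra.
move: (Defs.eta R) eta0 etapi hr hk hl => c eta0 etapi hr hk hl.
have : cexp (- ((2 * c)%:C * (x - y))) = (expR (2 * tau * (k - l)%:~R))%:C.
  rewrite mulrBr opprB addrC -[X in _ + X]opprK cexpD [cexp (- - _)]cexpN hk hl -fmorphV
    -rmorphM /= -expRN -expRD.
  by congr (expR _)%:C; rewrite rmorphB /=; ring.
move: hr hi; case: (x - y) (subr0_eq (V := C) (x := x) (y := y)) => a b eq_xy /= hr hi.
move=> /cexp_eq_real /=; rewrite !mul0r subr0 addr0 => -[ra _ sb].
have te0 : 0 < tau / c by rewrite divr_gt0.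
have ra' : (k - l)%:~R = - (a / (tau / c)).
  apply: (mulfI (lt0r_neq0 tau0)); apply: (mulfI (x := 2)) => //.
  by rewrite [LHS]mulrA -ra; field; rewrite !gt_eqF.
have kl : k - l = 0.
  apply/eqP; rewrite -normr_eq0 -[_ == _]negbK -normr_gt0 normr_id gtz0_ge1 -ltNge.
  by rewrite -(ltr_int R) intr_norm ra' normrN normrM normfV (gtr0_norm te0) ltr_pdivrMr // mul1r.
have a0 : a = 0.
  move: ra; rewrite kl mulr0 => /eqP; rewrite oppr_eq0 !mulf_eq0 pnatr_eq0 (gt_eqF eta0) /=.
  by move/eqP.
have b0 : b = 0.
  have : - (2 * c * b) = 0.
    apply: sin_eq0_small => //; rewrite normrN normrM gtr0_norm ?mulr_gt0 //.
    by apply: le_lt_trans etapi; rewrite ler_piMr ?mulr_ge0 // ltW.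
  move=> /eqP; rewrite oppr_eq0 !mulf_eq0 pnatr_eq0 (gt_eqF eta0) /=.
  by move/eqP.
by apply: eq_xy; rewrite a0 b0.
Qed.
End Theta.

(** * Evaluation of the fused functions on the cycle *)

Section Tuples.
Variables (V : comNzRingType).

(** The lower bound [c] on the entries makes the sum over sorted tuples recursive: the first entry
    bounds the rest. *)
Definition wsum (c m : nat) (g : nat -> 'I_3 -> V) :=
  \sum_(s : m.-tuple 'I_3 | path leq c (map val s)) \prod_(k < m) g k (tnth s k).

Lemma wsumS c m g : wsum c m.+1 g =
  \sum_(i : 'I_3 | (c <= i)%N) g 0%N i * wsum i m (fun k => g k.+1).
Proof.
under [RHS]eq_bigr do rewrite big_distrr /=.
rewrite pair_big_dep /= /wsum.
rewrite (reindex (fun x : 'I_3 * m.-tuple 'I_3 => [tuple of x.1 :: x.2])) /=; last first.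
  exists (fun s => (thead s, [tuple of behead s])).
    by move=> [i s] _; congr pair; apply/val_inj.
  by move=> s _; rewrite [RHS]tuple_eta.
apply: eq_bigr => -[i s] _; rewrite big_ord_recl tnth0; congr (_ * _).
by apply: eq_bigr => j _; rewrite tnthS.
Qed.

Lemma wsum0 c g : wsum c 0 g = 1.
Proof.
rewrite /wsum (big_pred1 [tuple]) ?big_ord0 // => s.
by rewrite [s]tuple0 /= eqxx.
Qed.

Lemma eq_wsum c m g g' : (forall k i, (k < m)%N -> g k i = g' k i) -> wsum c m g = wsum c m g'.
Proof. by move=> e; apply: eq_bigr => s _; apply: eq_bigr => k _; apply: e. Qed.

Lemma wsum_cons m g :
  [/\ wsum 0 m.+1 g = g 0%N ord0 * wsum 0 m (fun k => g k.+1) + wsum 1 m.+1 g,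
      wsum 1 m.+1 g = g 0%N (inord 1) * wsum 1 m (fun k => g k.+1) + wsum 2 m.+1 g &
      wsum 2 m.+1 g = g 0%N (inord 2) * wsum 2 m (fun k => g k.+1)].
Proof.
have i1 : inord 1 = lift ord0 (ord0 : 'I_2) :> 'I_3 by apply/val_inj; rewrite /= inordK.
have i2 : inord 2 = lift ord0 (lift ord0 (ord0 : 'I_1)) :> 'I_3 by apply/val_inj; rewrite /= inordK.
have sum3 c (G : 'I_3 -> V) : \sum_(i : 'I_3 | (c <= i)%N) G i =
    (if (c <= 0)%N then G ord0 else 0) + ((if (c <= 1)%N then G (inord 1) else 0)
    + (if (c <= 2)%N then G (inord 2) else 0)).
  by rewrite big_mkcond !big_ord_recl big_ord0 /= addr0 i1 i2.
by rewrite !wsumS !sum3 /= !add0r !inordK.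
Qed.
End Tuples.

(** * Zeros of [h], [phi] and [Q] are isolated *)

Section Near.
Variable R : realType.
Local Notation C := R[i].

Lemma near_punctured_shift (P : C -> Prop) (c : C) :
  (forall z : C, \forall x \near (z : C^o)^', P x) ->
  forall z : C, \forall x \near (z : C^o)^', P (x + c).
Proof.
move=> hP z; have := hP (z + c); rewrite !near_withinE => /nbhs_normP[e /= e0 he].
apply: (proj2 (@nbhs_normP _ C^o z _)); exists e => //= x xz xNz; apply: he => /=.
  by rewrite opprD addrACA subrr addr0.
by apply: contra_neq xNz => /addIr.
Qed.

(** Distinct zeros are at least [d] apart, so a disc of radius [d / 2] holds at most one. If that
    one is not the centre, the radius shrinks to its distance. *)
Lemma h_neq0_near (tau : R) (c z : C) : 0 < tau ->
  \forall x \near (z : C^o)^', h tau (x + c) != 0.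
Proof.
move=> tau0.
suff H (z' : C) : \forall x \near (z' : C^o)^', h tau x != 0.
  exact: (near_punctured_shift (P := fun x => h tau x != 0)).
pose d := Num.min (tau / Defs.eta R) 1.
have d0 : 0 < d by rewrite lt_min ltr01 andbT divr_gt0 // eta_gt0.
have d20 : 0 < (d / 2)%:C by rewrite ltcR divr_gt0.
have iso (x y : C) : h tau x = 0 -> h tau y = 0 -> `|x - y| < d%:C -> x = y.
  move=> hx hy xy; apply: (h_zeros_isolated tau0 hx hy).
    rewrite -ltcR (le_lt_trans (ler_normc_Re _)) // (lt_le_trans xy) // lecR.
    by rewrite ge_min lexx.
  rewrite -ltcR (le_lt_trans (ler_normc_Im _)) // (lt_le_trans xy) // lecR.
  by rewrite ge_min lexx orbT.
have [[x1 [x1z x1d hx1]]|none] :=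
  pselect (exists x1 : C, [/\ x1 != z', `|z' - x1| < (d / 2)%:C & h tau x1 = 0]).
- rewrite near_withinE; apply: (proj2 (@nbhs_normP _ C^o z' _)); exists `|z' - x1|;
  first by rewrite /= normr_gt0 subr_eq0 eq_sym.
  move=> x /= xz xNz; apply/eqP => hx.
  have e : x = x1.
    apply: iso => //; rewrite -(subrK z' x) -addrA (le_lt_trans (ler_normD _ _)) //.
    have -> : d%:C = (d / 2)%:C + (d / 2)%:C by rewrite -rmorphD /= -splitr.
    by rewrite ltrD // distrC (lt_trans xz).
  by move: xz; rewrite e ltxx.
rewrite near_withinE; apply: (proj2 (@nbhs_normP _ C^o z' _));
  exists (d / 2)%:C => //= x xz xNz; apply/eqP => hx.
by apply: none; exists x.
Qed.

Variables (tau u : R) (N : nat) (xs : 'I_N -> C).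
Local Notation phi := (dilute_phi tau u N).
Local Notation Q := (dilute_Q tau xs).

Lemma dilute_phi_period (x : C) : ~~ odd N -> phi (x + 10 / 3 * 'i%C) = phi x.
Proof.
move=> oN; rewrite /dilute_phi; congr (_ ^+ _).
by rewrite [x + _ + _]addrAC [x + _ - _]addrAC !h_period mulrNN.
Qed.

Lemma dilute_Q_period (x : C) : ~~ odd N -> Q (x + 10 / 3 * 'i%C) = Q x.
Proof.
move=> oN; rewrite /dilute_Q.
under eq_bigr do rewrite addrAC h_period -mulN1r.
by rewrite big_split /= prodr_const card_ord -signr_odd (negPf oN) mul1r.
Qed.

(** One nonzero value suffices: division by 0 gives 0 and the exponent [N./2] is positive, so it
    forces the constant denominator to be nonzero. *)
Lemma dilute_phi_neq0_near (z y : C) : 0 < tau -> phi y != 0 -> (1 < N)%N ->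
  \forall x \near (z : C^o)^', phi x != 0.
Proof.
move=> tau0 y0 N1.
have N20 : (0 < N./2)%N by rewrite half_gt0.
have : h tau (2 * 'i%C) * h tau (3 * 'i%C) != 0 :> C.
  apply: contra_neq y0 => e; rewrite /dilute_phi e invr0 mulr0 expr0n.
  by rewrite -[_ == 0%N]negbK -lt0n N20.
move=> den.
have h1 := h_neq0_near ((3 / 2 - u%:C) * 'i%C) z tau0.
have h2 := h_neq0_near (- ((3 / 2 - u%:C) * 'i%C)) z tau0.
near=> x; rewrite /dilute_phi expf_neq0 // mulf_neq0 ?invr_neq0 // mulf_neq0 //.
  by near: x.
by near: x.
Unshelve. all: by end_near.
Qed.

Lemma dilute_Q_neq0_near (z : C) : 0 < tau -> \forall x \near (z : C^o)^', Q x != 0.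
Proof.
move=> tau0.
have : \forall x \near (z : C^o)^', forall j : 'I_N, h tau (x - xs j) != 0.
  by apply: filter_forall => j; exact: h_neq0_near.
apply: filterS => x hx; rewrite /dilute_Q.
by apply/prodf_neq0 => j _; exact: hx.
Qed.
End Near.

(** * Boxes, rows and determinants at the points [x + p i/6] *)

Section LatticePoints.
Variable R : realType.
Local Notation C := R[i].
Variables (phi Q : C -> C) (x : C).

Definition lpt (p : int) : C := x + p%:~R / 6 * 'i%C.
Local Notation f := (fun p => phi (lpt p)).
Local Notation q := (fun p => Q (lpt p)).
Local Notation wR := (w R).

Lemma lptD p (k : int) (c : C) : c = k%:~R / 6 -> lpt p + c * 'i%C = lpt (p + k).
Proof. by move=> ->; rewrite /lpt rmorphD /=; ring. Qed.

Lemma lptB p (k : int) (c : C) : c = k%:~R / 6 -> lpt p - c * 'i%C = lpt (p - k).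
Proof. by move=> ->; rewrite /lpt rmorphB /=; ring. Qed.

Lemma b1_lpt p : b1 phi Q (lpt p) = lat_b1 wR f q p.
Proof.
rewrite /b1 /lat_b1 !(@lptD p 9 (3 / 2)) ?(@lptD p 3 (1 / 2)) ?(@lptB p 15 (5 / 2))
  ?(@lptB p 3 (1 / 2)) //.
all: by field.
Qed.

Lemma b2_lpt p : b2 phi Q (lpt p) = lat_b2 f q p.
Proof.
rewrite /b2 /lat_b2 !(@lptD p 9 (3 / 2)) ?(@lptD p 3 (1 / 2)) ?(@lptB p 9 (3 / 2))
  ?(@lptB p 3 (1 / 2)) //.
all: by field.
Qed.

Lemma b3_lpt p : b3 phi Q (lpt p) = lat_b3 wR f q p.
Proof.
rewrite /b3 /lat_b3 !(@lptB p 9 (3 / 2)) ?(@lptB p 3 (1 / 2)) ?(@lptD p 15 (5 / 2))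
  ?(@lptD p 3 (1 / 2)) //.
all: by field.
Qed.

Definition lbox (i : 'I_3) (p : int) := box phi Q i (lpt p).

(** Rows are anchored at their last box [e] while [wsum] peels off the first, hence the distance
    [m.-1 - k] from the end. *)
Lemma wsum_rows e m :
  let g k i := lbox i (e - (12 * (m.-1 - k))%N%:Z) in
  [/\ wsum 0 m g = row1 wR f q e m, wsum 1 m g = row2 wR f q e m & wsum 2 m g = row3 wR f q e m].
Proof.
elim: m => [|m [IH1 IH2 IH3]] g; first by rewrite !wsum0.
have [-> -> ->] := wsum_cons m g.
have e1 c : wsum c m (fun k => g k.+1) = wsum c m (fun k i => lbox i (e - (12 * (m.-1 - k))%N%:Z)).
  by apply: eq_wsum => k i km; rewrite /g /= -[m.-1]subn1 -subnDA add1n.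
by rewrite !e1 IH1 IH2 IH3 /g /lbox /box /= subn0 !inordK // b1_lpt b2_lpt b3_lpt.
Qed.

Lemma f_row_lpt m p : f_row phi m.+1 (lpt p) = lat_f f m p.
Proof.
(* Reversed, the shifts become [j + 1 / 2], the order of [lat_f]. *)
rewrite /f_row big_nat_rev big_add1 /=.
rewrite (eq_big_nat _ _ (F2 := fun j => f (p + (6 * j + 3)%N%:Z) * f (p - (6 * j + 3)%N%:Z)));
  last first.
  move=> j /= jm.
  have e : (2 * m.+1%:R - 1) / 2 - (1 + m.+1 - j.+2)%:R = ((6 * j + 3)%N%:Z)%:~R / 6 :> C.
    by rewrite add1n !subSS natrB ?(ltnW jm) // -pmulrn natrD natrM -natr1; field.
  by rewrite /pm (lptD _ e) (lptB _ e).
elim: m => [|m IH]; first by rewrite big_geq.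
by rewrite big_nat_recr //= IH.
Qed.

Lemma T_lpt m p : T phi Q m%:Z (lpt p) = lat_T wR f q m p.
Proof.
case: m => [|m].
  have e : 1 / 2 = 3%:~R / 6 :> C by field.
  by rewrite /= /pm (lptD _ e) (lptB _ e).
rewrite [T _ _ _ _]/(T_row _ _ _ _) /T_row f_row_lpt div1r mulrC lat_TS; congr (_ / _).
have [<- _ _] := wsum_rows (p + (6 * m)%N%:Z) m.+1.
rewrite /wsum; apply: eq_big => [s|s _].
  by case: (map val s).
apply: eq_bigr => k _; rewrite /lbox; congr box.
rewrite mulrC (@lptD p ((6 * m)%N%:Z - (12 * (m - k))%N%:Z)) ?addrA //.
rewrite rmorphB /= -!pmulrn !natrM natrB; last by rewrite -ltnS.
by rewrite -!natr1; field.
Qed.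

Lemma Tflat_lpt (m k : int) n p p' : m = n%:Z -> (n <= 7)%N -> p' = p + 6 * k ->
  Tflat phi Q m (lpt p + 'i%C * k%:~R) = lat_T wR f q n p'.
Proof.
move=> -> n7 ->; rewrite /Tflat !lez_nat n7 /= mulrC (@lptD p (6 * k)).
  exact: (T_lpt n).
by rewrite intrM mulrC mulKf ?intr_eq0.
Qed.

Lemma Tflat_out m y : ~~ (0 <= m <= 7) -> Tflat phi Q m y = 0.
Proof. by rewrite /Tflat => /negPf ->. Qed.

Lemma det2 (G : nat -> nat -> C) :
  \det (\matrix_(i < 2, j < 2) G i j) = G 0%N 0%N * G 1%N 1%N - G 0%N 1%N * G 1%N 0%N.
Proof.
rewrite (expand_det_row _ ord0) !big_ord_recl big_ord0 /cofactor !det_mx11 !mxE /=.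
rewrite /bump /= expr0 expr1; ring.
Qed.

Lemma det3 (G : nat -> nat -> C) : \det (\matrix_(i < 3, j < 3) G i j) =
  G 0%N 0%N * (G 1%N 1%N * G 2%N 2%N - G 1%N 2%N * G 2%N 1%N)
  - G 0%N 1%N * (G 1%N 0%N * G 2%N 2%N - G 1%N 2%N * G 2%N 0%N)
  + G 0%N 2%N * (G 1%N 0%N * G 2%N 1%N - G 1%N 1%N * G 2%N 0%N).
Proof.
have minor k : row' ord0 (col' k (\matrix_(i < 3, j < 3) G i j))
    = \matrix_(i < 2, j < 2) G i.+1 (bump k j).
  by apply/matrixP => i j; rewrite !mxE.
rewrite (expand_det_row _ ord0) !big_ord_recl big_ord0 /cofactor !minor.
rewrite !(det2 (fun i j => G i.+1 (bump _ j))) !mxE /bump /= !expr0 !expr1 sqrrN expr1n; ring.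
Qed.

Definition Lentry (mu la : seq nat) (y : C) (j k : nat) : C :=
  Tflat phi Q ((nth 0%N mu j)%:Z - (nth 0%N la k)%:Z - j.+1%:Z + k.+1%:Z)
    (y + 'i%C * ((size mu)%:Z - (nth 0%N mu 0)%:Z + (nth 0%N mu j)%:Z
               + (nth 0%N la k)%:Z - j.+1%:Z - k.+1%:Z + 1)%:~R).

Lemma Lambda61 p : Lambda phi Q [:: 6; 1]%N [::] (lpt p)
  = lat_T wR f q 6 (p + 6) * lat_T wR f q 1 (p - 36) - lat_T wR f q 7 p * lat_T wR f q 0 (p - 30).
Proof.
apply: etrans (det2 (Lentry [:: 6; 1]%N [::] (lpt p))) _.
by congr (_ * _ - _ * _); apply: Tflat_lpt => //=; lia.
Qed.

Lemma Lambda11_6_6 p : Lambda phi Q [:: 11; 6; 6]%N [:: 5; 5]%N (lpt p)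
  = lat_T wR f q 6 (p + 42) * (lat_T wR f q 1 p * lat_T wR f q 6 (p - 42)
      - lat_T wR f q 7 (p - 36) * lat_T wR f q 0 (p - 6))
  - lat_T wR f q 7 (p + 36) * (lat_T wR f q 0 (p + 6) * lat_T wR f q 6 (p - 42)).
Proof.
apply: etrans (det3 (Lentry [:: 11; 6; 6]%N [:: 5; 5]%N (lpt p))) _.
(* The corner indices are 13 and -1, where [Tflat] is 0; the matrix is tridiagonal. *)
have z02 : Lentry [:: 11; 6; 6]%N [:: 5; 5]%N (lpt p) 0 2 = 0 by apply: Tflat_out.
have z20 : Lentry [:: 11; 6; 6]%N [:: 5; 5]%N (lpt p) 2 0 = 0 by apply: Tflat_out.
rewrite z02 z20 mul0r addr0 mulr0 subr0.
by congr (_ * (_ * _ - _ * _) - _ * (_ * _)); apply: Tflat_lpt => //=; lia.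
Qed.
End LatticePoints.

(** * The system at a point whose whole cycle is generic *)

Section E7AtPoint.
Variable R : realType.
Local Notation C := R[i].
Variables (phi Q : C -> C) (x : C).
Local Notation pt := (lpt x).
Local Notation f := (fun p => phi (pt p)).
Local Notation q := (fun p => Q (pt p)).
Local Notation t m := (lat_T (w R) f q m).
Local Notation r := (1 / (Num.sqrt (2 : R))%:C).
Local Notation F := (fun p => r * lat_F (w R) f q p).

Hypothesis phi_per : forall y : C, phi (y + 10 / 3 * 'i%C) = phi y.
Hypothesis Q_per : forall y : C, Q (y + 10 / 3 * 'i%C) = Q y.
Hypothesis phi_n0 : forall p, phi (pt p) != 0.
Hypothesis Q_n0 : forall p, Q (pt p) != 0.
Hypothesis T52 : forall p, T phi Q 5 (pt p) = T phi Q 2 (pt p).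
Hypothesis T61 : forall p, T phi Q 6 (pt p) = T phi Q 1 (pt p).
Hypothesis T70 : forall p, T phi Q 7 (pt p) = T phi Q 0 (pt p).
Hypothesis T43 : forall p, T phi Q 4 (pt p) = T phi Q 3 (pt p).
Hypothesis T9 : forall p, T phi Q 9 (pt p) = 0.
Hypothesis T10 : forall p, T phi Q 10 (pt p) = T phi Q 0 (pt p).
Hypothesis T11 : forall p, T phi Q 11 (pt p) = T phi Q 1 (pt p).

Let fper p : phi (pt (p + 20)) = phi (pt p).
Proof.
have e : 10 / 3 = 20%:~R / 6 :> C by field.
by rewrite -(lptD _ _ e) phi_per.
Qed.

Let qper p : Q (pt (p + 20)) = Q (pt p).
Proof.
have e : 10 / 3 = 20%:~R / 6 :> C by field.
by rewrite -(lptD _ _ e) Q_per.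
Qed.

Let tper m p : t m (p + 20) = t m p.
Proof. exact: (lat_T_per (w R) fper qper m p). Qed.

Let Fper p : F (p + 20) = F p.
Proof. by congr (_ * _); exact: (lat_F_per (w R) fper qper p). Qed.

(** The factors [r] of two values of [F] absorb the 2 in the product formulas for [lat_F]. *)
Let rr2 : r * r * 2 = 1.
Proof.
rewrite !div1r -fmorphV -rmorphM /= -invfM -expr2 sqr_sqrtr // fmorphV rmorph_nat.
by rewrite mulVf.
Qed.

Let t52 p : t 5 p = t 2 p. Proof. by rewrite -!T_lpt T52. Qed.
Let t61 p : t 6 p = t 1 p. Proof. by rewrite -!T_lpt T61. Qed.
Let t70 p : t 7 p = t 0 p. Proof. by rewrite -!T_lpt T70. Qed.
Let t43 p : t 4 p = t 3 p. Proof. by rewrite -!T_lpt T43. Qed.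
Let t9 p : t 9 p = 0. Proof. by rewrite -!T_lpt T9. Qed.
Let t10 p : t 10 p = t 0 p. Proof. by rewrite -!T_lpt T10. Qed.
Let t11 p : t 11 p = t 1 p. Proof. by rewrite -!T_lpt T11. Qed.

Let FF1 p : F (p - 1) * F (p + 1) = sysT0 f p + t 2 (p + 10).
Proof.
rewrite mulrACA (lat_FF1 fper qper phi_n0 Q_n0 (w_exp5 R) (t10 p)).
by rewrite mulrA rr2 mul1r t52.
Qed.
Let FF3 p : F (p - 3) * F (p + 3) = t 3 p.
Proof.
rewrite mulrACA (lat_FF3 fper qper phi_n0 Q_n0 (w_exp5 R) (t9 (p + 10))).
by rewrite mulrA rr2 mul1r t43.
Qed.
Let FF5 p : F (p - 5) * F (p + 5) = t 1 p + t 1 (p + 10).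
Proof.
rewrite mulrACA (lat_FF5 fper qper phi_n0 Q_n0 (w_exp5 R) (t11 p)).
by rewrite mulrA rr2 mul1r t61.
Qed.
Let ribbon p : t 2 (p + 8) * t 2 (p - 8) - sysT0 f p * t 3 p = sysT3 f (t 1) p.
Proof. rewrite -t43; exact: (lat_ribbon22 fper qper phi_n0 Q_n0 (w_exp5 R) p). Qed.

Let col2 p := lat_col2 fper qper phi_n0 Q_n0 (w_exp5 R) p.
Let hookl p := lat_hookl fper qper phi_n0 Q_n0 (w_exp5 R) p.
Let hookr p := lat_hookr fper qper phi_n0 Q_n0 (w_exp5 R) p.

Let lptDi p : pt p + 'i%C = pt (p + 6).
Proof. by rewrite -(@lptD _ x p 6 1) ?mul1r //; field. Qed.

Let lptBi p : pt p - 'i%C = pt (p - 6).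
Proof. by rewrite -(@lptB _ x p 6 1) ?mul1r //; field. Qed.

Lemma TE2_lpt p : TE2 phi Q (pt p) = sysT2 f (t 1) p.
Proof.
have e : 5 / 6 = 5%:~R / 6 :> C by [].
have e' : 5 / 3 = 10%:~R / 6 :> C by field.
rewrite /TE2 (lptB x p e) (lptB x p e') Lambda61 t61 t70 mulrC div1r /sysT2.
have E m a b (k : int) : a = b + 20 * k -> t m a = t m b by apply: per_eq; exact: tper.
rewrite (E 1%N (p - 5 + 6) (p + 1) 0) ?(E 1%N (p - 5 - 36) (p - 1) (-2))
  ?(E 0%N (p - 5 - 30) (p + 5) (-2)) //; lia.
Qed.

Lemma TE3_lpt p : TE3 phi Q (pt p) = sysT3 f (t 1) p.
Proof.
have e : 3 / 2 = 9%:~R / 6 :> C by field.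
rewrite /TE3 /pm (lptB x p e) (lptD x p e) Lambda11_6_6 !t61 !t70 mulrC div1r /sysT3.
have E m a b (k : int) : a = b + 20 * k -> t m a = t m b by apply: per_eq; exact: tper.
rewrite (E 1%N (p + 42) (p + 2) 2) ?(E 1%N (p - 42) (p - 2) (-2)) ?(E 0%N (p - 36) (p + 4) (-2))
  ?(E 0%N (p + 36) (p - 4) 2); try lia.
by congr (_ / _); rewrite /sysT0 /lat_T; ring.
Qed.

Lemma TE5_lpt p : TE5 phi Q (pt p) = t 2 (p + 10).
Proof.
have e : 5 / 3 = 10%:~R / 6 :> C by field.
by rewrite /TE5 (lptD x p e) T_lpt.
Qed.

Lemma TE6_lpt p : TE6 phi Q (pt p) = F p.
Proof.
have v2 : 1 / 3 = 2%:~R / 6 :> C by field.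
have v4 : 2 / 3 = 4%:~R / 6 :> C by field.
have v8 : 4 / 3 = 8%:~R / 6 :> C by field.
have v10 : 5 / 3 = 10%:~R / 6 :> C by field.
rewrite /TE6 !(lptD x p v2, lptD x p v4, lptDi p, lptD x p v8, lptD x p v10,
  lptB x p v2, lptB x p v4, lptBi p, lptB x p v8, lptB x p v10) /lat_F.
by [].
Qed.

Lemma TE4_lpt p : TE4 phi Q (pt p) = sysT4 f (t 2) F p.
Proof.
have v2 : 1 / 3 = 2%:~R / 6 :> C by field.
have v4 : 2 / 3 = 4%:~R / 6 :> C by field.
rewrite /TE4 !(lptD x p v2, lptD x p v4, lptB x p v2, @lptB _ _ p 1 (1 / 6) erefl) TE5_lpt !TE6_lpt.
by rewrite /sysT4 (_ : p - 1 + 10 = p + 9) //; lia.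
Qed.

Lemma TE7_lpt p : TE7 phi Q (pt p) = sysT7 f (t 1) F p.
Proof.
have v3 : 1 / 2 = 3%:~R / 6 :> C by field.
have v4 : 2 / 3 = 4%:~R / 6 :> C by field.
have v8 : 4 / 3 = 8%:~R / 6 :> C by field.
rewrite /TE7 !(lptD x p v3, lptD x p v4, lptDi p, lptD x p v8,
  lptB x p v4, lptBi p, lptB x p v8) /TE1 T_lpt !TE6_lpt /sysT7.
by rewrite div1r mulrC.
Qed.

Lemma e7_system_at (y := pt 0) (T0 := T phi Q 0)
    (T1 := TE1 phi Q) (T2 := TE2 phi Q) (T3 := TE3 phi Q) (T4 := TE4 phi Q)
    (T5 := TE5 phi Q) (T6 := TE6 phi Q) (T7 := TE7 phi Q) :
  [/\ T1 (y - 1 / 6 * 'i%C) * T1 (y + 1 / 6 * 'i%C)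
        = phi (y - 5 / 3 * 'i%C) * T2 y + pm T0 y (5 / 6),
      T2 (y - 1 / 6 * 'i%C) * T2 (y + 1 / 6 * 'i%C)
        = T0 y * pm T0 y (4 / 6) + T1 y * T3 y &
      T3 (y - 1 / 6 * 'i%C) * T3 (y + 1 / 6 * 'i%C)
        = pm T0 y (1 / 2) * pm T0 y (1 / 6) + T2 y * T4 y * T7 y] /\
  [/\ T4 (y - 1 / 6 * 'i%C) * T4 (y + 1 / 6 * 'i%C)
        = T0 y * pm T0 y (1 / 3) + T3 y * T5 y,
      T5 (y - 1 / 6 * 'i%C) * T5 (y + 1 / 6 * 'i%C)
        = pm T0 y (1 / 6) + T4 y * T6 y,
      T6 (y - 1 / 6 * 'i%C) * T6 (y + 1 / 6 * 'i%C) = T0 y + T5 y &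
      T7 (y - 1 / 6 * 'i%C) * T7 (y + 1 / 6 * 'i%C) = pm T0 y (1 / 3) + T3 y].
Proof.
have u1 : 1 / 6 = 1%:~R / 6 :> C by [].
have u2 : 1 / 3 = 2%:~R / 6 :> C by field.
have u3 : 1 / 2 = 3%:~R / 6 :> C by field.
have u4 : 4 / 6 = 4%:~R / 6 :> C by [].
have u5 : 5 / 6 = 5%:~R / 6 :> C by [].
have u10 : 5 / 3 = 10%:~R / 6 :> C by field.
rewrite /pm !(lptD x 0 u1, lptB x 0 u1, lptD x 0 u2, lptB x 0 u2, lptD x 0 u3, lptB x 0 u3,
  lptD x 0 u4, lptB x 0 u4, lptD x 0 u5, lptB x 0 u5, lptB x 0 u10).
rewrite /T1 /T2 /T3 /T4 /T5 /T6 /T7 /T0 /y /TE1 !T_lpt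
  !(TE2_lpt, TE3_lpt, TE4_lpt, TE5_lpt, TE6_lpt, TE7_lpt).
split; split.
- exact: (e7_id1 (t 1) phi_n0 0).
- exact: (e7_id2 fper (tper 1) phi_n0 0).
- exact: (e7_id3 fper (tper 1) (tper 2) (tper 3) Fper phi_n0 FF1 FF3 FF5 hookr ribbon 0).
- exact: (e7_id4 fper (tper 2) (tper 3) Fper FF1 FF3 ribbon 0).
- exact: (e7_id5 fper (tper 2) Fper FF1 0).
- exact: (FF1 0).
- exact: (e7_id7 fper (tper 1) (tper 2) (tper 3) Fper phi_n0 FF1 FF3 FF5 col2 hookl 0).
Qed.
End E7AtPoint.

(** * Genericity off a discrete set and the conclusion *)

Section GenericPoints.
Variable R : realType.
Local Notation C := R[i].
Variables (phi Q : C -> C).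

Definition generic (y : C) : Prop := [/\ phi y != 0 /\ Q y != 0,
  T phi Q 5 y = T phi Q 2 y /\ T phi Q 6 y = T phi Q 1 y,
  T phi Q 7 y = T phi Q 0 y /\ T phi Q 4 y = T phi Q 3 y &
  [/\ T phi Q 9 y = 0, T phi Q 10 y = T phi Q 0 y & T phi Q 11 y = T phi Q 1 y]].

Hypothesis phi_per : forall y : C, phi (y + 10 / 3 * 'i%C) = phi y.
Hypothesis Q_per : forall y : C, Q (y + 10 / 3 * 'i%C) = Q y.

Lemma generic_lpt_per x p : generic (lpt x (p + 20)) = generic (lpt x p).
Proof.
have e : 10 / 3 = 20%:~R / 6 :> C by field.
have fper k : phi (lpt x (k + 20)) = phi (lpt x k) by rewrite -(lptD _ _ e).
have qper k : Q (lpt x (k + 20)) = Q (lpt x k) by rewrite -(lptD _ _ e).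
have tper m : T phi Q (Posz m) (lpt x (p + 20)) = T phi Q (Posz m) (lpt x p).
  rewrite !T_lpt; exact: (@lat_T_per _ (w R) (fun k => phi (lpt x k)) (fun k => Q (lpt x k))
    fper qper m p).
by rewrite /generic fper qper (tper 0) (tper 1) (tper 2) (tper 3) (tper 4) (tper 5) (tper 6)
  (tper 7) (tper 9) (tper 10) (tper 11).
Qed.

(** By periodicity the condition for all [p] reduces to 20 shifts, and finitely many punctured
    neighbourhoods intersect in one. *)
Lemma generic_lpt_near (z : C) : (forall z' : C, \forall y \near (z' : C^o)^', generic y) ->
  \forall x \near (z : C^o)^', forall p, generic (lpt x p).
Proof.
move=> hg.
have : \forall x \near (z : C^o)^', forall k : 'I_20, generic (lpt x k%:Z).
  by apply: filter_forall => k; exact: (near_punctured_shift _ hg).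
apply: filterS => x hx p.
have k20 : (`|(p %% 20)%Z| < 20)%N by rewrite -ltz_nat gez0_abs ?modz_ge0 ?ltz_pmod.
rewrite (_ : generic (lpt x p) = generic (lpt x (Ordinal k20)%:Z)); first exact: hx.
apply: (per_eq (f := fun p => generic (lpt x p)) (generic_lpt_per x) (k := (p %/ 20)%Z)).
by rewrite /= gez0_abs ?modz_ge0 // mulrC addrC -divz_eq.
Qed.
End GenericPoints.

Theorem proposition1 (R : realType) (tau u : R) (N : nat) (xs : 'I_N -> R[i])
    (phi := dilute_phi tau u N) (Q := dilute_Q tau xs)
    (T0 := T phi Q 0)
    (T1 := TE1 phi Q) (T2 := TE2 phi Q) (T3 := TE3 phi Q) (T4 := TE4 phi Q)
    (T5 := TE5 phi Q) (T6 := TE6 phi Q) (T7 := TE7 phi Q) :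
  0 < tau -> (0 < N)%N -> ~~ odd N ->
  bethe_equations phi Q xs ->
  largest_eigenvalue_sector phi Q ->
  mero_eq (fun x => T1 (x - 1 / 6 * 'i%C) * T1 (x + 1 / 6 * 'i%C))
          (fun x => phi (x - 5 / 3 * 'i%C) * T2 x + pm T0 x (5 / 6)) /\
  mero_eq (fun x => T2 (x - 1 / 6 * 'i%C) * T2 (x + 1 / 6 * 'i%C))
          (fun x => T0 x * pm T0 x (4 / 6) + T1 x * T3 x) /\
  mero_eq (fun x => T3 (x - 1 / 6 * 'i%C) * T3 (x + 1 / 6 * 'i%C))
          (fun x => pm T0 x (1 / 2) * pm T0 x (1 / 6) + T2 x * T4 x * T7 x) /\
  mero_eq (fun x => T4 (x - 1 / 6 * 'i%C) * T4 (x + 1 / 6 * 'i%C))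
          (fun x => T0 x * pm T0 x (1 / 3) + T3 x * T5 x) /\
  mero_eq (fun x => T5 (x - 1 / 6 * 'i%C) * T5 (x + 1 / 6 * 'i%C))
          (fun x => pm T0 x (1 / 6) + T4 x * T6 x) /\
  mero_eq (fun x => T6 (x - 1 / 6 * 'i%C) * T6 (x + 1 / 6 * 'i%C))
          (fun x => T0 x + T5 x) /\
  mero_eq (fun x => T7 (x - 1 / 6 * 'i%C) * T7 (x + 1 / 6 * 'i%C))
          (fun x => pm T0 x (1 / 3) + T3 x).
Proof.
move=> tau0 N0 evenN bethe [hT [_ h9] hper _].
have N1 : (1 < N)%N.
  by case: N N0 evenN {xs phi Q T0 T1 T2 T3 T4 T5 T6 T7 bethe hT h9 hper} => [|[]].
(* The Bethe equations only serve to exclude [h[2i] h[3i] = 0]. *)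
have [phi_n0 _ _] := bethe (Ordinal N0).
have phi_per y : phi (y + 10 / 3 * 'i%C) = phi y := dilute_phi_period tau u y evenN.
have Q_per y : Q (y + 10 / 3 * 'i%C) = Q y := dilute_Q_period tau xs y evenN.
have gen (z : R[i]) : \forall y \near (z : R[i]^o)^', generic phi Q y.
  have g1 := dilute_phi_neq0_near z tau0 phi_n0 N1; have g2 := dilute_Q_neq0_near xs z tau0.
  have g3 := hT 5 isT z; have g4 := hT 6 isT z; have g5 := hT 7 isT z; have g6 := hT 4 isT z.
  have g9 := h9 z; have g10 := hper 0 isT z; have g11 := hper 1 isT z.
  by near=> y; split; split; near: y.
have at_generic z := generic_lpt_near phi_per Q_per z gen.
have sys (x : R[i]) : (forall p, generic phi Q (lpt x p)) -> _ := fun hx =>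
  e7_system_at phi_per Q_per (fun p => let: And4 (conj h _) _ _ _ := hx p in h)
    (fun p => let: And4 (conj _ h) _ _ _ := hx p in h)
    (fun p => let: And4 _ (conj h _) _ _ := hx p in h)
    (fun p => let: And4 _ (conj _ h) _ _ := hx p in h)
    (fun p => let: And4 _ _ (conj h _) _ := hx p in h)
    (fun p => let: And4 _ _ (conj _ h) _ := hx p in h)
    (fun p => let: And4 _ _ _ (And3 h _ _) := hx p in h)
    (fun p => let: And4 _ _ _ (And3 _ h _) := hx p in h)
    (fun p => let: And4 _ _ _ (And3 _ _ h) := hx p in h).
have lpt0 (x : R[i]) : lpt x 0 = x by rewrite /lpt mul0r mul0r addr0.
do 6 (split; first by move=> z; apply: filterS (at_generic z) => x /sys;
  rewrite lpt0 => -[[? ? ?] [? ? ? ?]]).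
by move=> z; apply: filterS (at_generic z) => x /sys; rewrite lpt0 => -[[? ? ?] [? ? ? ?]].
Unshelve. all: by end_near.
Qed.
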